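(* Let $a\in(0,1)$ and $f(u)=(1-u)(u-a)$ (Nagumo's equation). Assume $0\le u_0(\boldsymbol{x})\le 1$ and $0\le g(\boldsymbol{x},t)\le 1$ for all $\boldsymbol{x}$ and $t$. Let $(\boldsymbol{u}^n)_{n\ge 0}$ be generated by the explicit-reaction scheme $$(M+\Delta t_n A)\,\boldsymbol{u}^{n+1} = (M+\Delta t_n\, C(\boldsymbol{u}^n))\,\boldsymbol{u}^{n}+\Delta t_n\,\boldsymbol{g}^{n+1},\qquad n=0,1,\ldots,$$ where $C(\boldsymbol{u}^n)=(c_{ij})$ is the $N_v\times N_v$ matrix with $c_{ij}=\int_\Omega f(u_h^n)\,\phi_j\phi_i\,d\boldsymbol{x}$ for $i=1,\ldots,N_{vi}$ and $c_{ij}=0$ for $i=N_{vi}+1,\ldots,N_v$ ($j=1,\ldots,N_v$). Suppose that the mesh satisfies the anisotropic nonobtuse angle condition, i.e. $\mathbb{D}_{acute}\ge 0$, and that the time step satisfies $$\frac{\left(\frac{|\Omega|}{N_e}\right)^{2/d}}{(d+1)(d+2)\,\mathbb{D}_{acute}}\ \le\ \Delta t_n\ \le\ \frac{1}{\max_{\boldsymbol{x}}\left\{|f^{-}(u_h^n)|,\ \left|\left(u_h^n(a-u_h^n)\right)^{-}\right|\right\}},\qquad n=0,1,\ldots$$ Then the scheme preserves nonnegativity and boundedness: $0\le u_j^n\le 1$ for all $j=1,\ldots,N_v$ and all $n\ge 0$ (equivalently, $0\le u_h^n\le 1$ on $\Omega$ for all $n\ge 0$).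
   Context: Continuous problem: $\partial_t u-\nabla\cdot(\mathbb{D}\nabla u)=u f(u)$ in $\Omega\times(0,T]$, $u=g$ on $\partial\Omega\times(0,T]$, $u(\cdot,0)=u_0$ in $\Omega$. Here $d\in\{1,2,3\}$, $\Omega\subset\mathbb{R}^d$ is a connected bounded polygonal or polyhedral domain, $T>0$; the diffusion tensor $\mathbb{D}=\mathbb{D}(\boldsymbol{x})$ is a $d\times d$ matrix function that is continuous (and integrable over $\Omega$), symmetric and uniformly positive definite on $\Omega$; $u_0$ and $g$ are given functions (with $u_0$ defined at all mesh vertices). Mesh: $\mathcal{T}_h$ is a (conforming) simplicial triangulation of $\Omega$ with $N_e$ elements, $N_v$ vertices $\boldsymbol{x}_1,\ldots,\boldsymbol{x}_{N_v}$, of which the first $N_{vi}$ are the interior vertices (not on $\partial\Omega$). $\phi_j$ is the continuous piecewise linear basis function with $\phi_j(\boldsymbol{x}_i)=\delta_{ij}$. $|K|$ and $|\Omega|$ denote volumes; $\mathbb{D}_K$ is the average of $\mathbb{D}$ over $K\in\mathcal{T}_h$. Matrices: $M=(m_{ij})$ with $m_{ij}=\int_\Omega\phi_j\phi_i\,d\boldsymbol{x}$ for $i\le N_{vi}$ and $m_{ij}=0$ for $i>N_{vi}$; $A=(a_{ij})$ with $a_{ij}=\int_\Omega(\nabla\phi_i)^T\mathbb{D}\nabla\phi_j\,d\boldsymbol{x}=\sum_{K\in\mathcal{T}_h}|K|(\nabla\phi_i)^T\mathbb{D}_K\nabla\phi_j$ (gradients taken on $K$) for $i\le N_{vi}$ and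 $a_{ij}=\delta_{ij}$ for $i>N_{vi}$ ($j=1,\ldots,N_v$). Time levels: $0=t_0<t_1<\cdots$ in $[0,T]$, $\Delta t_n=t_{n+1}-t_n$. The vector $\boldsymbol{u}^n=(u_1^n,\ldots,u_{N_v}^n)^T$ contains the nodal values of $u_h^n=\sum_{j=1}^{N_v}u_j^n\phi_j$, with initial vector $u_j^0=u_0(\boldsymbol{x}_j)$. $\boldsymbol{g}^{n+1}$ has entries $0$ for $i\le N_{vi}$ and $g(\boldsymbol{x}_i,t_{n+1})$ for $i>N_{vi}$. Mesh quantity: for each $K\in\mathcal{T}_h$ let $\phi_0,\ldots,\phi_d$ denote (local numbering) the linear basis functions on $K$ of its $d+1$ vertices, and set $$\mathbb{D}_{acute}=\left(\frac{|\Omega|}{N_e}\right)^{2/d}\min_{K\in\mathcal{T}_h}\ \min_{i,j=0,\ldots,d,\ i\ne j}\left(-(\nabla\phi_i)^T\mathbb{D}_K\nabla\phi_j\right).$$ The anisotropic nonobtuse angle condition is: $(\nabla\phi_i)^T\mathbb{D}_K\nabla\phi_j\le 0$ for all $i\ne j$ and all $K$, i.e. $\mathbb{D}_{acute}\ge 0$. Notation: $v^+=\max\{v,0\}$, $v^-=\min\{v,0\}$; $\max_{\boldsymbol{x}}$ is the maximum over $\overline{\Omega}$, and $\max_{\boldsymbol{x}}\{p,q\}$ is the maximum over $\overline{\Omega}$ of the larger of $p$ and $q$. A fraction with positive numerator and zero denominator is read as $+\infty$ (so the lower bound on $\Delta t_n$ cannot be met if $\mathbb{D}_{acute}=0$,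 and there is no upper bound if the maximum is $0$). *)

(* Defs.v *)
From HB Require Import structures.
From mathcomp Require Import all_boot all_order all_algebra.
From mathcomp Require Import all_classical all_reals all_analysis.
Set Implicit Arguments.
Unset Strict Implicit.
Unset Printing Implicit Defensive.
Import Order.TTheory GRing.Theory Num.Theory.
Import numFieldNormedType.Exports.
Local Open Scope classical_set_scope.
Local Open Scope ring_scope.

Definition measure_rV_display : measure_display -> measure_display.
Proof. exact. Qed.

Section measurable_rV.
Context {d} {T : measurableType d}.
Variable n : nat.

Let coors : 'I_n -> 'rV[T]_n -> T := fun i x => x 0 i.

Let rV_set0 : g_sigma_preimage coors set0.
Proof. exact: sigma_algebra0. Qed.

Let rV_setC A : g_sigma_preimage coors A -> g_sigma_preimage coors (~` A).
Proof. exact: sigma_algebraC. Qed.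

Let rV_bigcup (F : (set 'rV[T]_n)^nat) :
  (forall i, g_sigma_preimage coors (F i)) ->
  g_sigma_preimage coors (\bigcup_i (F i)).
Proof. exact: sigma_algebra_bigcup. Qed.

(* The product sigma-algebra, as for tuples in the library. *)
HB.instance Definition _ := @isMeasurable.Build (measure_rV_display d)
  'rV[T]_n (g_sigma_preimage coors) rV_set0 rV_setC rV_bigcup.

Lemma measurable_rV_coord (i : 'I_n) :
  measurable_fun [set: 'rV[T]_n] (fun x : 'rV[T]_n => x 0 i).
Proof.
move=> _ Y mY; rewrite setTI; apply: sub_sigma_algebra => /=.
rewrite -bigcup_seq/=; exists i => /=; first by rewrite mem_index_enum.
by exists Y => //; rewrite setTI.
Qed.

Lemma measurable_rV_box (A : 'I_n -> set T) : (forall i, measurable (A i)) ->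
  measurable [set x : 'rV[T]_n | forall i, A i (x 0 i)].
Proof.
move=> mA.
have -> : [set x : 'rV[T]_n | forall i, A i (x 0 i)] =
    \bigcap_(i in [set: 'I_n]) ((fun x : 'rV[T]_n => x 0 i) @^-1` A i).
  by apply/seteqP; split => x /= Ax i => [_|]; exact: Ax.
apply: fin_bigcap_measurable => // i _.
by rewrite -[X in measurable X]setTI; exact: measurable_rV_coord.
Qed.

Lemma measurable_fun_rVP d1 (T1 : measurableType d1) (f : T1 -> 'rV[T]_n) :
  (forall i, measurable_fun [set: T1] (fun x => f x 0 i)) ->
  measurable_fun [set: T1] f.
Proof.
move=> mf _ A mA; rewrite setTI.
suff: g_sigma_preimage coors `<=` [set A | measurable (f @^-1` A)] by apply.
apply: smallest_sub; first split => /=.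
- by rewrite preimage_set0; exact: measurable0.
- by move=> B mB; rewrite setTD preimage_setC; exact: measurableC.
- by move=> F mF; rewrite preimage_bigcup; exact: bigcupT_measurable.
- rewrite -bigcup_seq => B [i _ [C mC <-]] /=; rewrite setTI.
  by have := mf i measurableT _ mC; rewrite setTI.
Qed.

End measurable_rV.

Section lebesgue_measure_rV.
Variable R : realType.

Definition cons_rV n (p : R * 'rV[R]_n) : 'rV[R]_n.+1 := row_mx p.1%:M p.2.

Lemma cons_rV0 n p : @cons_rV n p 0 ord0 = p.1.
Proof.
have -> : @ord0 n = lshift n (@ord0 0) by exact: val_inj.
by rewrite /cons_rV [LHS]row_mxEl mxE eqxx mulr1n.
Qed.

Lemma cons_rVS n p (i : 'I_n) : cons_rV p 0 (lift ord0 i) = p.2 0 i.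
Proof.
have -> : lift ord0 i = rshift 1 i by exact: val_inj.
by rewrite /cons_rV [LHS]row_mxEr.
Qed.

Lemma measurable_cons_rV n : measurable_fun setT (@cons_rV n).
Proof.
apply: measurable_fun_rVP => i.
have [j ->|->] := unliftP ord0 i; last first.
  by under eq_fun do rewrite cons_rV0; exact: measurable_fst.
under eq_fun do rewrite cons_rVS.
exact: (measurableT_comp (measurable_rV_coord j) measurable_snd).
Qed.

Section step.
Variables (n : nat) (mu : {sigma_finite_measure set 'rV[R]_n -> \bar R}).

Definition cons_measure : set 'rV[R]_n.+1 -> \bar R :=
  pushforward (@lebesgue_measure R \x mu)%E (@cons_rV n).

Let cons_measure0 : cons_measure set0 = 0%E.
Proof. by rewrite /cons_measure /pushforward preimage_set0 measure0. Qed.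

Let cons_measure_ge0 A : (0 <= cons_measure A)%E.
Proof. by rewrite /cons_measure /pushforward measure_ge0. Qed.

Let cons_measure_sigma_additive : semi_sigma_additive cons_measure.
Proof.
move=> F mF tF mUF; rewrite /cons_measure /pushforward preimage_bigcup.
have mc A : measurable A -> measurable (@cons_rV n @^-1` A).
  by move=> mA; rewrite -[X in measurable X]setTI; exact: measurable_cons_rV.
apply: measure_semi_sigma_additive.
- by move=> k; exact: mc.
- apply/trivIsetP => /= i j _ _ ij; rewrite -preimage_setI.
  by move/trivIsetP : tF => /(_ _ _ _ _ ij) ->//; rewrite preimage_set0.
- by rewrite -preimage_bigcup; exact: mc.
Qed.

HB.instance Definition _ := isMeasure.Build _ _ _
  cons_measure cons_measure0 cons_measure_ge0 cons_measure_sigma_additive.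

Lemma cons_measure_box (A : 'I_n.+1 -> set R) : (forall i, measurable (A i)) ->
  cons_measure [set x : 'rV[R]_n.+1 | forall i, A i (x 0 i)] =
  (lebesgue_measure (A ord0) *
   mu [set x : 'rV[R]_n | forall i : 'I_n, A (lift ord0 i) (x 0%R i)])%E.
Proof.
move=> mA; rewrite /cons_measure /pushforward.
rewrite (_ : _ @^-1` _ =
    A ord0 `*` [set x : 'rV[R]_n | forall i : 'I_n, A (lift ord0 i) (x 0%R i)]); last first.
  apply/seteqP; split => -[x y] /= Axy.
    split => [|i]; first by have := Axy ord0; rewrite cons_rV0.
    by have := Axy (lift ord0 i); rewrite cons_rVS.
  move: Axy => [/= A0 AS] i; have [j ->|->] := unliftP ord0 i.
    by rewrite cons_rVS.
  by rewrite cons_rV0.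
rewrite product_measure1E//; first exact: mA.
by apply: (@measurable_rV_box _ _ n (fun i => A (lift ord0 i))).
Qed.

Let cons_measure_sigma_finite : sigma_finite setT cons_measure.
Proof.
have /sigma_finiteP[F [TF ndF Foo]] := sigma_finiteT (@lebesgue_measure R).
have /sigma_finiteP[G [TG ndG Goo]] := sigma_finiteT mu.
pose tl (x : 'rV[R]_n.+1) : 'rV[R]_n := \row_i x 0 (lift ord0 i).
have mtl : measurable_fun setT tl.
  apply: measurable_fun_rVP => i.
  by under eq_fun do rewrite mxE; exact: measurable_rV_coord.
exists (fun k => ((fun x : 'rV[R]_n.+1 => x 0 ord0) @^-1` F k) `&`
                 (tl @^-1` G k)).
  apply/seteqP; split => // x _.
  have [i _ Fi] : (\bigcup_i F i) (x 0 ord0) by rewrite -TF.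
  have [j _ Gj] : (\bigcup_i G i) (tl x) by rewrite -TG.
  exists (maxn i j) => //; split => /=.
    by move: Fi; apply/subsetPset/ndF/leq_maxl.
  by move: Gj; apply/subsetPset/ndG/leq_maxr.
move=> k; have [mF Fk] := Foo k; have [mG Gk] := Goo k; split.
  apply: measurableI.
    by rewrite -[X in measurable X]setTI; exact: measurable_rV_coord.
  by rewrite -[X in measurable X]setTI; exact: mtl.
rewrite /cons_measure /pushforward.
rewrite (_ : _ @^-1` _ = F k `*` G k).
  by rewrite product_measure1E// lte_mul_pinfty// ge0_fin_numE.
have tlK p : tl (cons_rV p) = p.2.
  by apply/rowP => i; rewrite mxE cons_rVS.
by apply/seteqP; split => p /= []; rewrite cons_rV0 tlK.
Qed.

HB.instance Definition _ := Measure_isSigmaFinite.Build _ _ _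
  cons_measure cons_measure_sigma_finite.

End step.

(* R^0 is a point of mass 1; R^(n+1) carries the image of the product measure
   under (x, y) |-> row_mx x y. *)
Fixpoint lebesgue_rV n : {sigma_finite_measure set 'rV[R]_n -> \bar R} :=
  match n with
  | 0 => \d_(0 : 'rV[R]_0)
  | n'.+1 => cons_measure (lebesgue_rV n')
  end.

Lemma lebesgue_rV_box n (A : 'I_n -> set R) : (forall i, measurable (A i)) ->
  lebesgue_rV n [set x : 'rV[R]_n | forall i, A i (x 0 i)] =
  (\prod_(i < n) lebesgue_measure (A i))%E.
Proof.
elim: n A => [|n IH] A mA /=.
  by rewrite big_ord0 diracE mem_set//= => -[].
rewrite cons_measure_box// big_ord_recl; congr (_ * _)%E.
by apply: (IH (fun i => A (lift ord0 i))).
Qed.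

End lebesgue_measure_rV.

Section domain.
Variables (R : realType) (d : nat).
Implicit Types Omega : set 'rV[R]_d.

Definition boundary Omega : set 'rV[R]_d := closure Omega `\` interior Omega.

(* A bounded domain is an interval, polygonal or polyhedral (d = 1, 2, 3) when
   its boundary lies on finitely many points, lines or planes; h.1 is the
   normal vector of a hyperplane and h.2 its offset. *)
Definition polyhedral_domain Omega : Prop :=
  [/\ open Omega, Omega !=set0, connected Omega, bounded_set Omega &
      exists H : seq ('cV[R]_d * R),
        (forall h, h \in H -> h.1 != 0) /\
        boundary Omega `<=`
          [set x | exists2 h, h \in H & (x *m h.1) 0 0 = h.2]].

Definition diffusion_tensor Omega (D : 'rV[R]_d -> 'M[R]_d) : Prop :=
  [/\ {within Omega, continuous D},
      (forall i j,
        (lebesgue_rV R d).-integrable Omega (fun x => (D x i j)%:E)),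
      (forall x, Omega x -> (D x)^T = D x) &
      exists2 alpha : R, 0 < alpha &
        forall x, Omega x -> forall v : 'cV[R]_d,
          alpha * (v^T *m v) 0 0 <= (v^T *m D x *m v) 0 0].

Definition vol (A : set 'rV[R]_d) : R := fine (lebesgue_rV R d A).

Definition grad (f : 'rV[R]_d -> R) (x : 'rV[R]_d) : 'cV[R]_d :=
  \col_k 'D_(delta_mx 0 k) f x.

End domain.

(* An element is given by the set of (indices of) its vertices. *)
Record mesh (R : realType) (d : nat) := Mesh {
  nvert : nat;
  nint : nat;
  vertex : 'I_nvert -> 'rV[R]_d;
  elements : {set {set 'I_nvert}}
}.

Section finite_elements.
Variables (R : realType) (d : nat) (Omega : set 'rV[R]_d) (m : mesh R d).
Implicit Types K L : {set 'I_(nvert m)}.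

Local Notation mu := (lebesgue_rV R d).

Definition hull K : set 'rV[R]_d :=
  [set x | exists w : 'I_(nvert m) -> R,
    [/\ forall i, i \in K -> 0 <= w i, \sum_(i in K) w i = 1 &
        x = \sum_(i in K) w i *: vertex i]].

Definition affinely_independent K : Prop :=
  forall w : 'I_(nvert m) -> R,
    \sum_(i in K) w i = 0 -> \sum_(i in K) w i *: vertex i = 0 ->
    forall i, i \in K -> w i = 0.

Record triangulation : Prop := Triangulation {
  vertex_inj : injective (@vertex _ _ m);
  vertex_used : forall i, exists2 K, K \in elements m & i \in K;
  element_card : forall K, K \in elements m -> #|K| = d.+1;
  element_nondegenerate :
    forall K, K \in elements m -> affinely_independent K;
  elements_cover : closure Omega = \bigcup_(K in [set` elements m]) hull K;
  elements_conforming : forall K L, K \in elements m -> L \in elements m ->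
    hull K `&` hull L = hull (K :&: L);
  nint_le : (nint m <= nvert m)%N;
  interior_first : forall i : 'I_(nvert m),
    (i < nint m)%N <-> ~ boundary Omega (vertex i)
}.

(* These conditions determine phi on the closure of Omega, and nothing below
   depends on its values elsewhere. *)
Record nodal_basis (phi : 'I_(nvert m) -> 'rV[R]_d -> R) : Prop := NodalBasis {
  phi_continuous : forall j, {within closure Omega, continuous (phi j)};
  phi_linear : forall j K, K \in elements m ->
    exists (b : 'cV[R]_d) (c : R),
      forall x, hull K x -> phi j x = (x *m b) 0 0 + c;
  phi_vertex : forall i j, phi j (vertex i) = (i == j)%:R
}.

Definition barycenter K : 'rV[R]_d :=
  #|K|%:R^-1 *: \sum_(i in K) vertex i.

Section scheme.
Variables (D : 'rV[R]_d -> 'M[R]_d) (phi : 'I_(nvert m) -> 'rV[R]_d -> R).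

(* The constant gradient of phi j on K, read off at an interior point of K. *)
Definition grad_on K j : 'cV[R]_d := grad (phi j) (barycenter K).

(* D is only given on the open set Omega; K may meet the boundary of Omega in
   a null set. *)
Definition average_on K : 'M[R]_d :=
  \matrix_(i, j) ((vol (hull K))^-1 * \int[mu]_(x in hull K `&` Omega) D x i j).

Definition mass_matrix : 'M[R]_(nvert m) :=
  \matrix_(i, j) if (i < nint m)%N
    then \int[mu]_(x in Omega) (phi j x * phi i x) else 0.

Definition stiffness_matrix : 'M[R]_(nvert m) :=
  \matrix_(i, j) if (i < nint m)%N
    then \int[mu]_(x in Omega)
           ((grad (phi i) x)^T *m D x *m grad (phi j) x) 0 0
    else (i == j)%:R.

Definition fe_function (u : 'cV[R]_(nvert m)) (x : 'rV[R]_d) : R :=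
  \sum_j u j 0 * phi j x.

Definition reaction_matrix (f : R -> R) (u : 'cV[R]_(nvert m)) :
    'M[R]_(nvert m) :=
  \matrix_(i, j) if (i < nint m)%N
    then \int[mu]_(x in Omega) (f (fe_function u x) * phi j x * phi i x)
    else 0.

Definition boundary_vector (g : 'rV[R]_d -> R -> R) (s : R) :
    'cV[R]_(nvert m) :=
  \col_i if (i < nint m)%N then 0 else g (vertex i) s.

Definition mesh_scale : R :=
  (vol Omega / #|elements m|%:R) `^ (2%:R / d%:R).

(* The infimum is over a finite nonempty set, so it is the minimum. *)
Definition D_acute : R :=
  mesh_scale *
  inf [set v | exists K i j,
    [/\ K \in elements m, i \in K, j \in K, i != j &
        v = - ((grad_on K i)^T *m average_on K *m grad_on K j) 0 0]].

End scheme.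

End finite_elements.

Section nagumo.
Variables (R : realType) (a : R).

Definition nagumo (u : R) : R := (1 - u) * (u - a).

(* v^- = min(v, 0); the supremum is a maximum, since the closure of Omega is
   compact and uh is continuous there. *)
Definition reaction_bound d (Omega : set 'rV[R]_d) (uh : 'rV[R]_d -> R) : R :=
  sup [set Num.max `|Num.min (nagumo (uh x)) 0|
                   `|Num.min (uh x * (a - uh x)) 0| | x in closure Omega].

End nagumo.

(* Main.v *)
(* In an interior row, the matrix [B = M + dt A] has nonpositive off-diagonal
   entries, by the lower bound on [dt], and row sum [int phi_i > 0], because the
   gradients of the [phi_j] add up to zero; a boundary row is [dt] times a row
   of the identity.  Looking at a minimal entry of [v], [B v >= 0] on the
   interior rows and [v >= 0] on the boundary ones give [v >= 0].  This applies
   to [u^(n+1)] and to [1 - u^(n+1)]: the interior entries of their images under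
   [B] are [int (1 + dt f(u_h)) u_h phi_i] and
   [int (1 - u_h) (1 + dt u_h (a - u_h)) phi_i], both nonnegative by the upper
   bound on [dt].

   The sign of the off-diagonal entries rests on
   [int_K phi_i phi_j <= |K| / ((d+1)(d+2))].  A linear bijection multiplies
   Lebesgue measure by a constant, so the mean over a simplex of a function of
   the barycentric coordinates [l_k] is the same for all simplices; in
   particular [p = mean (l_i l_j)] and [q = mean (l_i^2)] do not depend on the
   indices, and [(d+1) q + d (d+1) p = 1].  Cutting the simplex in two equal
   halves at the midpoint of an edge gives [p <= p/2 + q/4], that is
   [2 p <= q], hence [(d+1)(d+2) p <= 1]. *)
Require Import Defs.
From HB Require Import structures.
From mathcomp Require Import all_boot all_order all_algebra perm.
From mathcomp Require Import all_classical all_reals all_analysis.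
From mathcomp Require Import measurable_realfun ring lra.
Set Implicit Arguments.
Unset Strict Implicit.
Unset Printing Implicit Defensive.
Import Order.TTheory GRing.Theory Num.Theory.
Import numFieldNormedType.Exports.
Local Open Scope classical_set_scope.
Local Open Scope ring_scope.

(** * Translations and linear images of Lebesgue measure *)

Section lebesgue_rV_theory.
Context {R : realType}.

Lemma measurable_shift (a : R) :
  measurable_fun setT (fun x : measurableTypeR R => x + a : measurableTypeR R).
Proof. exact: measurable_funD. Qed.

(** Lebesgue measure on the line is determined by its values on half-open intervals, and a shift
    preserves their lengths. *)
Lemma lebesgue_measure_shift (a : R) (A : set R) : measurable A ->
  pushforward lebesgue_measure
    (fun x : measurableTypeR R => x + a : measurableTypeR R) A =
  lebesgue_measure A.
Proof.
move=> mA; apply/esym/lebesgue_measure_unique => //=.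
  exact: measurable_shift.
move=> _ _ [[s t]] _ <-.
rewrite /pushforward (_ : _ @^-1` _ = `]s - a, t - a]%classic).
  rewrite !lebesgue_measure_itv/= !lte_fin ltrD2r; case: ifP => // _.
  by rewrite -!EFinB; congr EFin; ring.
by apply/seteqP; split => x /=; rewrite !in_itv/= => /andP[h1 h2]; lra.
Qed.

Lemma measurable_shift_rV n (a : 'rV[R]_n) :
  measurable_fun setT (fun x : 'rV[R]_n => x + a).
Proof.
apply: measurable_fun_rVP => i.
under eq_fun do rewrite mxE.
by apply: measurable_funD => //; exact: measurable_rV_coord.
Qed.

(** Induction on the dimension: the shift acts separately on the first coordinate and on the others.
    The induction hypothesis removes it from each section, and invariance on the line removes it
    from the outer integral. *)
Lemma lebesgue_rV_shift n (a : 'rV[R]_n) (A : set 'rV[R]_n) : measurable A ->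
  lebesgue_rV R n ((fun x => x + a) @^-1` A) = lebesgue_rV R n A.
Proof.
elim: n a A => [|n IH] a A mA.
  rewrite (_ : _ @^-1` _ = A)//; apply/seteqP.
  by split => x /=; rewrite !thinmx0.
rewrite /= /cons_measure /pushforward.
set B := @cons_rV R n @^-1` A.
have mB : measurable B.
  by rewrite -[X in measurable X]setTI; exact: measurable_cons_rV.
pose a0 := a 0 ord0; pose a' : 'rV[R]_n := \row_i a 0 (lift ord0 i).
have aE s y : cons_rV (s, y) + a = cons_rV (s + a0, y + a').
  apply/rowP => i; rewrite mxE; have [j ->|->] := unliftP ord0 i.
    by rewrite !cons_rVS !mxE.
  by rewrite !cons_rV0.
set C := _ @^-1` _.
have CE s : xsection C s = (fun y => y + a') @^-1` xsection B (s + a0).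
  by apply/seteqP; split => y; rewrite /= /xsection/= !inE /C /B /= aE.
rewrite /product_measure1/=.
transitivity (\int[lebesgue_measure]_(s in setT)
    ((fun s => lebesgue_rV R n (xsection B s)) \o
     (fun s : measurableTypeR R => (s + a0)%R : measurableTypeR R)) s)%E.
  apply: eq_integral => s _ /=; rewrite CE IH//; exact: measurable_xsection.
rewrite -(@ge0_integral_pushforward _ _ _ _ _ _ (measurable_shift a0) _ setT)//.
- apply: eq_measure_integral => /= [|mS D mD _]; first exact: measurable_shift.
  exact: lebesgue_measure_shift.
- exact: (measurable_fun_xsection (lebesgue_rV R n) mB).
Qed.

Lemma ge0_integral_rV_shift n (a : 'rV[R]_n) (f : 'rV[R]_n -> \bar R) :
  measurable_fun setT f -> (forall x, 0 <= f x)%E ->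
  (\int[lebesgue_rV R n]_x f (x + a)%R = \int[lebesgue_rV R n]_x f x)%E.
Proof.
move=> mf f0.
rewrite -[LHS]/(\int[lebesgue_rV R n]_(x in (fun x => x + a)%R @^-1` setT)
   (f \o (fun x => x + a)%R) x)%E.
rewrite -(ge0_integral_pushforward (measurable_shift_rV a))//.
apply: eq_measure_integral => /= [|ms D mD _]; first exact: measurable_shift_rV.
exact: lebesgue_rV_shift.
Qed.

Lemma measurable_mulmx m n (A : 'M[R]_(m, n)) :
  measurable_fun setT (fun x : 'rV[R]_m => x *m A).
Proof.
apply: measurable_fun_rVP => i.
under eq_fun do rewrite mxE.
apply: measurable_sum => j.
by apply: measurable_funM => //; exact: measurable_rV_coord.
Qed.

Lemma measurable_mulmx_coord m n (A : 'M[R]_(m, n)) i :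
  measurable_fun setT (fun x : 'rV[R]_m => (x *m A) 0 i).
Proof. exact: measurableT_comp (measurable_rV_coord i) (measurable_mulmx A). Qed.

(* Uniqueness of Haar measure: both products equal the double integral of
   [f (x *m A + y) * g y], by translating [x] or by translating [y]. *)
Lemma ge0_integral_rV_mulmx n (A : 'M[R]_n) (f g : 'rV[R]_n -> \bar R) :
  A \in unitmx ->
  measurable_fun setT f -> (forall x, 0 <= f x)%E ->
  measurable_fun setT g -> (forall x, 0 <= g x)%E ->
  ((\int[lebesgue_rV R n]_x f (x *m A)) * (\int[lebesgue_rV R n]_x g x) =
  (\int[lebesgue_rV R n]_x f x) *
  (\int[lebesgue_rV R n]_x g (- (x *m A))%R))%E.
Proof.
move=> uA mf f0 mg g0; set mu := lebesgue_rV R n.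
have mfA : measurable_fun setT (fun x : 'rV[R]_n => f (x *m A)).
  exact: measurableT_comp (measurable_mulmx A).
have mfst k : measurable_fun setT (fun p : 'rV[R]_n * 'rV[R]_n => p.1 0 k).
  exact: measurableT_comp (measurable_rV_coord k) measurable_fst.
have msnd k : measurable_fun setT (fun p : 'rV[R]_n * 'rV[R]_n => p.2 0 k).
  exact: measurableT_comp (measurable_rV_coord k) measurable_snd.
have mT (h : 'rV[R]_n -> \bar R) a : measurable_fun setT h ->
    measurable_fun setT (fun x : 'rV[R]_n => h (x + a)).
  by move=> mh; exact: measurableT_comp (measurable_shift_rV a).
(* The scalar [s] lets one measurability statement serve both [F] ([s = 1]) and [G] ([s = -1]). *)
have mD (s : R) : measurable_fun setT
    (fun p : 'rV[R]_n * 'rV[R]_n => s *: (p.1 *m A) + p.2).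
  apply: measurable_fun_rVP => k; under eq_fun do rewrite !mxE.
  apply: measurable_funD => //; apply: measurable_funM => //.
  by apply: measurable_sum => j; exact: measurable_funM.
pose F (p : 'rV[R]_n * 'rV[R]_n) := (f (1 *: (p.1 *m A) + p.2)%R * g p.2)%E.
pose G (p : 'rV[R]_n * 'rV[R]_n) := (f p.2 * g (-1 *: (p.1 *m A) + p.2)%R)%E.
have mF : measurable_fun setT F.
  by apply: emeasurable_funM; apply: measurableT_comp => //; exact: mD.
have F0 p : (0 <= F p)%E by rewrite mule_ge0.
have mG : measurable_fun setT G.
  by apply: emeasurable_funM; apply: measurableT_comp => //; exact: mD.
have G0 p : (0 <= G p)%E by rewrite mule_ge0.
have FG x : (\int[mu]_y F (x, y) = \int[mu]_y G (x, y))%E.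
  rewrite -(@ge0_integral_rV_shift _ (- (x *m A)) (fun y => F (x, y)))//.
    apply: eq_integral => y _; rewrite /F /G/= scale1r addrCA subrr addr0.
    by rewrite scaleN1r addrC.
  exact: measurableT_comp.
transitivity (\int[mu]_y \int[mu]_x F (x, y))%E.
  rewrite muleC -ge0_integralZr//; last exact: integral_ge0.
  apply: eq_integral => y _.
  rewrite -(@ge0_integral_rV_shift _ (y *m invmx A)
    (fun x : 'rV[R]_n => f (x *m A)))//.
  rewrite -ge0_integralZl//; last first.
    exact: (mT (fun x : 'rV[R]_n => f (x *m A))).
  rewrite /F/=; apply: eq_integral => x _.
  by rewrite muleC mulmxDl mulmxKV// scale1r.
rewrite -fubini_tonelli//.
under eq_integral do rewrite FG.
rewrite fubini_tonelli//.
rewrite -ge0_integralZr//; last exact: integral_ge0.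
apply: eq_integral => y _.
have mgA : measurable_fun setT (fun x : 'rV[R]_n => g (- (x *m A))%R).
  apply: measurableT_comp => //.
  by under eq_fun do rewrite -mulmxN; exact: measurable_mulmx.
rewrite -(@ge0_integral_rV_shift _ (- (y *m invmx A)) (fun x : 'rV[R]_n =>
  g (- (x *m A))%R))// -ge0_integralZl//; last first.
  exact: (mT (fun x : 'rV[R]_n => g (- (x *m A))%R)).
rewrite /G/=; apply: eq_integral => x _.
by rewrite mulmxDl mulNmx mulmxKV// opprB addrC scaleN1r addrC.
Qed.

End lebesgue_rV_theory.

(** * Measures of open sets, bounded sets and hyperplanes *)

Section rV_topology_measure.
Context {R : realType}.

(** The sigma-algebra is generated by the coordinates, so an open set is exhibited as a countable
    union of boxes: those with rational centre and radius [1/(k+1)] that it contains. *)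
Lemma open_measurable_rV n (U : set 'rV[R]_n) : open U -> measurable U.
Proof.
move=> oU.
pose q2r (q : 'rV[rat]_n) : 'rV[R]_n := map_mx ratr q.
pose V (p : 'rV[rat]_n * nat) : set 'rV[R]_n :=
  [set x | forall i, ball (q2r p.1 0 i) p.2.+1%:R^-1 (x 0 i)].
pose W p := [set x | V p x /\ V p `<=` U].
have mV p : measurable (V p).
  apply: (@measurable_rV_box _ _ n (fun i => ball (q2r p.1 0 i) p.2.+1%:R^-1)).
  by move=> i; exact: measurable_ball.
have mW p : measurable (W p).
  have [sub|nsub] := pselect (V p `<=` U).
    by rewrite (_ : W p = V p)//; apply/seteqP; split => x => [[]|].
  by rewrite (_ : W p = set0)//; apply/seteqP; split => x => [[]|].
rewrite (_ : U = \bigcup_p W p); first exact: countable_bigcupT_measurable.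
apply/seteqP; split => [x Ux|x [p _ [Vx]]]; last exact.
have /nbhs_ballP[e /= e0 xeU] := open_nbhs_nbhs (conj oU Ux).
(* With radius below [e / 2], a box containing [x] stays inside the [e]-ball around [x]. *)
have [k] : exists k : nat, 0 + k.+1%:R^-1 < e / 2 by apply: ltr_add_invr; lra.
rewrite add0r => ke.
have k0 : 0 < k.+1%:R^-1 :> R by rewrite invr_gt0.
have hq i : exists q : rat, `|ratr q - x 0 i| < k.+1%:R^-1.
  have [|q] := @rat_in_itvoo R (x 0 i - k.+1%:R^-1) (x 0 i + k.+1%:R^-1).
    by rewrite ltrBlDr -addrA ltrDl addr_gt0.
  rewrite in_itv/= => /andP[h1 h2]; exists q.
  by rewrite ltr_norml ltrBlDl ltrBrDl h1.
have [q qP] := choice hq.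
exists (\row_i q i, k) => //; split.
  by move=> i /=; rewrite /q2r !mxE /ball/=; exact: qP.
move=> y /= Vy; apply: xeU; split => // i j; rewrite (ord1 i).
have := Vy j; rewrite /q2r !mxE /ball/= => yj.
have := qP j.
rewrite [`|ratr _ - x _ _|]distrC => xj.
rewrite /ball/= (splitr e); apply: (le_lt_trans (ler_distD (ratr (q j)) _ _)).
by rewrite ltrD// (lt_trans _ ke).
Qed.

Lemma lebesgue_rV_bounded n (A : set 'rV[R]_n) :
  measurable A -> bounded_set A -> (lebesgue_rV R n A < +oo)%E.
Proof.
move=> mA [M [_ AM]].
pose r := `|M| + 1; have rM : M < r by rewrite /r (le_lt_trans (ler_norm M)) ?ltrDl.
have r0 : 0 <= r by rewrite addr_ge0.
have mB (i : 'I_n) : measurable (ball (0 : R) (r + 1)) by exact: measurable_ball.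
pose B := [set x : 'rV[R]_n | forall i, ball (0 : R) (r + 1) (x 0 i)].
apply: (@le_lt_trans _ _ (lebesgue_rV R n B)).
  apply: le_measure; rewrite ?inE//.
    exact: (@measurable_rV_box _ _ n (fun=> ball (0 : R) (r + 1))).
  move=> x Ax i; have := AM _ rM _ Ax; rewrite /ball/= sub0r normrN => xr.
  rewrite (@le_lt_trans _ _ r) ?ltrDl// (le_trans _ xr)//.
  rewrite /Num.norm/= mx_normrE.
  exact: (le_bigmax _ (fun ij : 'I_1 * 'I_n => `|x ij.1 ij.2|) (ord0, i)).
rewrite (@lebesgue_rV_box _ _ (fun=> ball (0 : R) (r + 1)))//.
rewrite (eq_bigr (fun=> ((r + 1) *+ 2)%:E)) => [|i _].
  by rewrite prodEFin ltry.
by rewrite lebesgue_measure_ball// addr_ge0.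
Qed.

Lemma lebesgue_rV_open_gt0 n (U : set 'rV[R]_n) :
  open U -> U !=set0 -> (0 < lebesgue_rV R n U)%E.
Proof.
move=> oU [x Ux].
have /nbhs_ballP[e /= e0 xeU] := open_nbhs_nbhs (conj oU Ux).
have mB (i : 'I_n) : measurable (ball (x 0 i) e) by exact: measurable_ball.
pose B := [set y : 'rV[R]_n | forall i, ball (x 0 i) e (y 0 i)].
apply: (@lt_le_trans _ _ (lebesgue_rV R n B)).
  rewrite (@lebesgue_rV_box _ _ (fun i => ball (x 0 i) e))//.
  rewrite (eq_bigr (fun=> (e *+ 2)%:E)) => [|i _].
    by rewrite prodEFin lte_fin prodr_gt0// => i _; rewrite mulrn_wgt0.
  by rewrite lebesgue_measure_ball// ltW.
apply: le_measure; rewrite ?inE//.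
- exact: (@measurable_rV_box _ _ n (fun i => ball (x 0 i) e)).
- exact: open_measurable_rV.
- by move=> y By; apply: xeU; split => // i j; rewrite (ord1 i).
Qed.

(** Induction on the dimension. If the first entry of [h] vanishes, every section at a fixed first
    coordinate is again a hyperplane; otherwise fixing the remaining coordinates leaves a single
    point of the line. *)
Lemma lebesgue_rV_hyperplane n (h : 'cV[R]_n) (c : R) : h != 0 ->
  lebesgue_rV R n [set x | (x *m h) 0 0 = c] = 0%E.
Proof.
elim: n h c => [|n IH] h c; first by rewrite flatmx0 eqxx.
move=> h0; set A := [set x | _].
have mA : measurable A.
  have := measurable_mulmx_coord h 0 measurableT (measurable_set1 c).
  by rewrite setTI.
rewrite /= /cons_measure /pushforward.
set B := _ @^-1` _.
have mB : measurable B.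
  by rewrite -[X in measurable X]setTI; exact: measurable_cons_rV.
pose h' : 'cV[R]_n := \col_i h (lift ord0 i) 0.
have BE s y : B (s, y) <-> s * h ord0 0 + (y *m h') 0 0 = c.
  rewrite /B /A /= mxE big_ord_recl cons_rV0 /= mxE.
  under eq_bigr do rewrite cons_rVS.
  by under [X in _ <-> _ + X = _]eq_bigr do rewrite mxE.
have [h00|h00] := eqVneq (h ord0 0) 0.
  have h'0 : h' != 0.
    apply: contra h0 => /eqP h'0; apply/eqP/colP => i; rewrite mxE.
    have [j ->|->//] := unliftP ord0 i.
    by have /colP/(_ j) := h'0; rewrite !mxE.
  apply: integral0_eq => s _ /=; rewrite -[RHS](IH _ c h'0).
  congr (lebesgue_rV R n _).
  apply/seteqP; split => y; rewrite /xsection/= inE.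
    by move/BE; rewrite h00 mulr0 add0r.
  by move=> yc; apply/BE; rewrite h00 mulr0 add0r.
(* The product measure integrates over the first coordinate last; writing it as the integral of an
   indicator allows the order to be exchanged. *)
transitivity (\int[lebesgue_measure \x lebesgue_rV R n]_z (\1_B z)%:E)%E.
  by rewrite integral_indic// setIT.
have mI : measurable_fun setT (fun z => (\1_B z)%:E : \bar R).
  by apply/measurable_EFinP; exact: measurable_indic.
rewrite fubini_tonelli2//.
apply: integral0_eq => y _; rewrite /fubini_G.
pose s := (c - (y *m h') 0 0) / h ord0 0.
rewrite -[RHS](@lebesgue_measure_set1 R s).
transitivity (\int[@lebesgue_measure R]_x (\1_[set s] x)%:E)%E; last first.
  by rewrite integral_indic// setIT.
apply: eq_integral => t _; rewrite !indicE; congr (_%:R%:E).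
have ts : t * h ord0 0 + (y *m h') 0 0 = c <-> t = s.
  rewrite /s; split => [<-|->]; first by rewrite addrK mulfK.
  by rewrite divfK// subrK.
by congr (nat_of_bool _); apply/idP/idP;
  [move=> /set_mem/BE/ts ->; exact: mem_set
  |move=> /set_mem/= /ts tE; apply/mem_set/BE].
Qed.

Lemma continuous_mulmx_coord m n (A : 'M[R]_(m, n)) i :
  continuous (fun x : 'rV[R]_m => (x *m A) 0 i).
Proof.
under eq_fun do rewrite mxE.
apply: (@continuous_big R 'I_m +%R 0 xpredT); first exact: add_continuous.
move=> k _ x; apply: continuousM; first exact: coord_continuous.
exact: cst_continuous.
Qed.

End rV_topology_measure.

(** * Integrals and null sets *)

Lemma integrable_Rsum (disp : measure_display) (T : measurableType disp)
    (R : realType) (mu : {measure set T -> \bar R}) (D : set T) (I : Type)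
    (s : seq I) (f : I -> T -> R) : measurable D ->
  (forall i, mu.-integrable D (EFin \o f i)) ->
  mu.-integrable D (EFin \o (fun x => \sum_(i <- s) f i x)).
Proof.
move=> mD intf.
have := @integrable_sum _ _ _ mu D mD _ s xpredT _ (fun i _ => intf i).
apply: eq_integrable => // x _ /=; by rewrite sumEFin.
Qed.

Lemma Rintegral_sum (disp : measure_display) (T : measurableType disp)
    (R : realType) (mu : {measure set T -> \bar R}) (D : set T) (I : Type)
    (s : seq I) (f : I -> T -> R) : measurable D ->
  (forall i, mu.-integrable D (EFin \o f i)) ->
  \int[mu]_(x in D) (\sum_(i <- s) f i x) = \sum_(i <- s) \int[mu]_(x in D) f i x.
Proof.
move=> mD intf; elim: s => [|i s IH].
  rewrite big_nil -[RHS](mul0r (fine (mu D))) -Rintegral_cst//.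
by apply: eq_Rintegral => x _; rewrite big_nil.
rewrite big_cons -IH -RintegralD//; last exact: integrable_Rsum.
by apply: eq_Rintegral => x _; rewrite big_cons.
Qed.

Section integral_null_set.
Context {disp : measure_display} {T : measurableType disp} {R : realType}.
Variable mu : {measure set T -> \bar R}.
Local Open Scope ereal_scope.
Import HBNNSimple.

(* Unlike in [negligible_integral], [f] need not be measurable (the gradient of
   a nodal basis function is a junk value on the faces of the elements): a simple
   function below [f] stays so after being cut off on the null set. *)
Lemma ge0_integral_setD_null (D N : set T) (f : T -> \bar R) :
  measurable N -> mu N = 0 -> (forall x, 0 <= f x) ->
  \int[mu]_(x in D) f x = \int[mu]_(x in D `\` N) f x.
Proof.
move=> mN N0 f0; rewrite integral_mkcond [RHS]integral_mkcond.
have p0 E x : 0 <= (f \_ E) x by rewrite patchE; case: ifP.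
rewrite !ge0_integralTE//; apply/eqP; rewrite eq_le; apply/andP; split.
- apply: ge_ereal_sup => _ [h hf <-]; apply: ereal_sup_ubound.
  have mCN : measurable (~` N) by exact: measurableC.
  exists (proj_nnsfun h mCN) => [x /=|].
    rewrite mindicE; have := hf x; rewrite !patchE in_setD.
    have -> : (x \in ~` N) = (x \notin N) by rewrite in_setC.
    by case: (x \in D); case: (x \notin N); rewrite ?mulr1 ?mulr0.
  rewrite -!integralT_nnsfun.
  rewrite [RHS](ge0_negligible_integral mN)//; last first.
  - by move=> x _; rewrite lee_fin.
  - exact/measurable_EFinP.
  rewrite setTD [RHS]integral_mkcond; apply: eq_integral => x _.
  by rewrite /= patchE mindicE; case: ifP; rewrite ?mulr1 ?mulr0.
- apply: le_ereal_sup => _ [h hf <-]; exists h => // x.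
  apply: le_trans (hf x) _; rewrite !patchE in_setD.
  by case: (x \in D); case: (x \notin N).
Qed.

Lemma integral_setD_null (D N : set T) (f : T -> \bar R) :
  measurable N -> mu N = 0 ->
  \int[mu]_(x in D) f x = \int[mu]_(x in D `\` N) f x.
Proof.
move=> mN N0; rewrite integralE [RHS]integralE.
by congr (_ - _); exact: ge0_integral_setD_null.
Qed.

End integral_null_set.

Lemma measurable_fun_bigsetU (disp disp' : measure_display)
    (T : measurableType disp) (U : measurableType disp') (I : eqType)
    (s : seq I) (F : I -> set T) (f : T -> U) :
  (forall i, i \in s -> measurable (F i)) ->
  (forall i, i \in s -> measurable_fun (F i) f) ->
  measurable_fun (\big[setU/set0]_(i <- s) F i) f.
Proof.
elim: s => [|i s IH] mF mf; first by rewrite big_nil; exact: measurable_fun_set0.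
have is_ : i \in i :: s by rewrite mem_head.
have sub j : j \in s -> j \in i :: s by rewrite in_cons orbC => ->.
rewrite big_cons; apply/measurable_funU; first exact: mF.
  by rewrite big_seq; apply: bigsetU_measurable => j /sub/mF.
by split; [exact: mf|apply: IH => j /sub; [exact: mF|exact: mf]].
Qed.

Lemma null_bigsetU (disp : measure_display) (T : measurableType disp)
    (R : realType) (mu : {measure set T -> \bar R}) (I : Type) (s : seq I)
    (P : pred I) (F : I -> set T) :
  (forall i, P i -> measurable (F i) /\ mu (F i) = 0%E) ->
  measurable (\big[setU/set0]_(i <- s | P i) F i) /\
  mu (\big[setU/set0]_(i <- s | P i) F i) = 0%E.
Proof.
move=> PF; apply: (@big_ind _ (fun A => measurable A /\ mu A = 0%E)) => //.
move=> A B [mA A0] [mB B0]; split; first exact: measurableU.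
apply: measure_negligible; first exact: measurableU.
by apply: negligibleU; exact/negligibleP.
Qed.

Lemma Rintegral_subset (disp : measure_display) (T : measurableType disp)
    (R : realType) (mu : {measure set T -> \bar R}) (A B : set T) (f : T -> R) :
  measurable A -> measurable B -> A `<=` B ->
  mu.-integrable B (EFin \o f) -> (forall x, B x -> 0 <= f x) ->
  \int[mu]_(x in A) f x <= \int[mu]_(x in B) f x.
Proof.
move=> mA mB AB intf f0; apply: fine_le.
- by apply: integrable_fin_num => //; exact: integrableS intf.
- exact: integrable_fin_num.
- apply: ge0_subset_integral => //; exact: (measurable_int mu intf).
Qed.

Section integral_partition.
Context {disp : measure_display} {T : measurableType disp} {R : realType}.
Variable mu : {measure set T -> \bar R}.

(** The part of [D] outside all [F i] lies in [N] and drops out, leaving a finite disjoint union.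
    Integrability is assumed piece by piece, because on the null set [f] may take junk values. *)
Lemma Rintegral_partition (I : finType) (D N : set T) (F : I -> set T)
    (f : T -> R) :
  measurable D -> measurable N -> mu N = 0%E ->
  (forall i, measurable (F i)) -> trivIset [set: I] F ->
  D `\` N `<=` \bigcup_i F i ->
  (forall i, mu.-integrable (D `&` F i) (EFin \o f)) ->
  \int[mu]_(x in D) f x = \sum_i \int[mu]_(x in D `&` F i) f x.
Proof.
move=> mD mN N0 mF tF DNF intf.
pose E := D `\` \big[setU/set0]_(i <- enum I) F i.
have mU : measurable (\big[setU/set0]_(i <- enum I) F i).
  by apply: bigsetU_measurable.
have mE : measurable E by exact: measurableD.
have E0 : mu E = 0%E.
  apply: (subset_measure0 mE mN) => // x [Dx nFx]; apply: contrapT => Nx.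
  have [i _ Fix] := DNF x (conj Dx Nx); apply: nFx.
  by rewrite -bigcup_seq; exists i => //=; rewrite mem_enum.
rewrite /Rintegral (integral_setD_null _ _ mE E0).
have -> : D `\` E = \big[setU/set0]_(i <- enum I) (D `&` F i).
  by rewrite /E setDD -!bigcup_seq setI_bigcupr.
have mDF i : measurable (D `&` F i) by exact: measurableI.
rewrite integral_bigsetU_EFin//; last 3 first.
- exact: enum_uniq.
- by apply: trivIset_setIl; apply: sub_trivIset tF.
- by apply: measurable_fun_bigsetU => // i _; exact: (measurable_int mu (intf i)).
rewrite big_enum/=.
transitivity (fine (\sum_i (\int[mu]_(x in D `&` F i) f x)%:E)).
  congr fine; apply: eq_bigr => i _; rewrite fineK//.
  by apply: integrable_fin_num => //; exact: intf.
by rewrite sumEFin.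
Qed.

End integral_partition.

(** * Barycentric coordinates *)

Section barycentric.
Context {R : realType} {d : nat}.
Implicit Types (P : 'I_d.+1 -> 'rV[R]_d) (x : 'rV[R]_d) (w : 'rV[R]_d.+1).

Lemma measurable_orthant :
  measurable [set w : 'rV[R]_d.+1 | forall i, 0 <= w 0 i].
Proof.
have mI (i : 'I_d.+1) : measurable (`[0, +oo[%classic : set R) by [].
have := measurable_rV_box mI; congr (measurable _).
by apply/seteqP; split => x /= h i; have := h i; rewrite in_itv/= andbT.
Qed.

(** Homogeneous coordinates: with a leading 1 in each row, weights and weighted sum of the vertices
    are read off together from [w *m vertex_mx P], and affine independence becomes invertibility. *)
Definition vertex_mx P : 'M[R]_d.+1 := \matrix_i cons_rV (1, P i).

Definition simplex_nondeg P := vertex_mx P \in unitmx.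

Definition bary P x : 'rV[R]_d.+1 := cons_rV (1, x) *m invmx (vertex_mx P).

Definition simplex P : set 'rV[R]_d := [set x | forall i, 0 <= bary P x 0 i].

Lemma vertex_mxE P i k : vertex_mx P i k = cons_rV (1, P i) 0 k.
Proof. by rewrite [LHS]mxE. Qed.

Lemma mulmx_vertex_mx P w :
  w *m vertex_mx P = cons_rV (\sum_i w 0 i, \sum_i w 0 i *: P i).
Proof.
apply/rowP => k; rewrite mxE; have [j ->|->] := unliftP ord0 k.
  rewrite cons_rVS summxE; apply: eq_bigr => i _.
  by rewrite vertex_mxE cons_rVS mxE.
rewrite cons_rV0; apply: eq_bigr => i _.
by rewrite vertex_mxE cons_rV0 mulr1.
Qed.

Lemma simplex_nondegP P :
  (forall w, \sum_i w 0 i = 0 -> \sum_i w 0 i *: P i = 0 -> w = 0) ->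
  simplex_nondeg P.
Proof.
move=> h; rewrite /simplex_nondeg -row_free_unit; apply: inj_row_free => w.
rewrite mulmx_vertex_mx => /rowP w0; apply: h.
  by have := w0 ord0; rewrite cons_rV0 mxE.
by apply/rowP => k; have := w0 (lift ord0 k); rewrite cons_rVS !mxE.
Qed.

Lemma bary_sum P x : simplex_nondeg P ->
  \sum_i bary P x 0 i = 1 /\ \sum_i bary P x 0 i *: P i = x.
Proof.
move=> uP; have : bary P x *m vertex_mx P = cons_rV (1, x) by rewrite mulmxKV.
rewrite mulmx_vertex_mx => /rowP e; split.
  by have := e ord0; rewrite !cons_rV0.
by apply/rowP => k; have := e (lift ord0 k); rewrite !cons_rVS.
Qed.

Lemma bary_comb P w : simplex_nondeg P -> \sum_i w 0 i = 1 ->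
  bary P (\sum_i w 0 i *: P i) = w.
Proof. by move=> uP w1; rewrite /bary -w1 -mulmx_vertex_mx mulmxK. Qed.

Lemma bary_vertex P i j : simplex_nondeg P -> bary P (P i) 0 j = (i == j)%:R.
Proof.
move=> uP; rewrite -[P i in LHS](_ :
  \sum_k (delta_mx 0 i : 'rV[R]_d.+1) 0 k *: P k = _).
  rewrite bary_comb//; first by rewrite mxE eqxx /= eq_sym.
  rewrite (bigD1 i)//= big1 => [|k ki]; rewrite mxE !eqxx ?addr0//=.
  by rewrite (negbTE ki).
rewrite (bigD1 i)//= big1 => [|k ki]; rewrite mxE !eqxx ?addr0/= ?scale1r//.
by rewrite (negbTE ki) scale0r.
Qed.

(** The linear part of the affine map [bary P]: column [i] is the gradient of the barycentric
    coordinate [i]. *)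
Definition bary_lin P : 'M[R]_(d, d.+1) :=
  \matrix_(k, i) invmx (vertex_mx P) (lift ord0 k) i.

Lemma baryE P x : bary P x = bary P 0 + x *m bary_lin P.
Proof.
have e y : bary P y = row ord0 (invmx (vertex_mx P)) + y *m bary_lin P.
  apply/rowP => i; rewrite [LHS]mxE big_ord_recl cons_rV0 mul1r.
  rewrite [RHS]mxE; congr (_ + _); first by rewrite mxE.
  by rewrite [RHS]mxE; apply: eq_bigr => k _; rewrite cons_rVS [in RHS]mxE.
by rewrite e [bary P 0]e mul0mx addr0.
Qed.

Lemma bary_perm P (s : {perm 'I_d.+1}) x i : simplex_nondeg P ->
  simplex_nondeg (P \o s) /\ bary (P \o s) x 0 i = bary P x 0 (s i).
Proof.
move=> uP.
have us : simplex_nondeg (P \o s).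
  rewrite /simplex_nondeg (_ : vertex_mx _ = row_perm s (vertex_mx P)).
    by rewrite row_permE unitmx_mul unitmx_perm.
  by apply/matrixP => k l; rewrite !mxE.
split=> //.
have [s1 sx] := bary_sum x uP.
pose w : 'rV[R]_d.+1 := \row_k bary P x 0 (s k).
have wE : \sum_k w 0 k *: (P \o s) k = x.
  rewrite -[RHS]sx [RHS](reindex_inj (@perm_inj _ s))/=.
  by apply: eq_bigr => k _; rewrite mxE.
have -> : bary (P \o s) x = w; last by rewrite mxE.
rewrite -[X in bary _ X]wE bary_comb// -s1 [RHS](reindex_inj (@perm_inj _ s)).
by apply: eq_bigr => k _; rewrite mxE.
Qed.

Lemma measurable_bary P : measurable_fun setT (bary P).
Proof.
apply: measurableT_comp (measurable_mulmx (invmx (vertex_mx P))) _.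
apply: measurableT_comp (@measurable_cons_rV R d) _.
exact: measurable_fun_pair.
Qed.

Lemma measurable_bary_coord P i : measurable_fun setT (fun x => bary P x 0 i).
Proof. exact: measurableT_comp (measurable_rV_coord i) (measurable_bary P). Qed.

Lemma measurable_simplex P : measurable (simplex P).
Proof.
have := measurable_bary P measurableT measurable_orthant.
by rewrite setTI.
Qed.

Lemma simplex_bary_le1 P x i : simplex_nondeg P -> simplex P x ->
  0 <= bary P x 0 i <= 1.
Proof.
by move=> uP Px; rewrite Px/= -(bary_sum x uP).1 (bigD1 i)//= lerDl sumr_ge0.
Qed.

Lemma simplex_bounded P : simplex_nondeg P -> bounded_set (simplex P).
Proof.
move=> uP; exists (\sum_i `|P i|); split; first exact: num_real.
move=> M ltM x Px; rewrite /= -(bary_sum x uP).2.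
apply: le_trans (ler_norm_sum _ _ _) (le_trans _ (ltW ltM)).
apply: ler_sum => i _; rewrite normrZ.
have /andP[h0 h1] := simplex_bary_le1 i uP Px.
by rewrite ger0_norm// ler_piMl.
Qed.

Lemma continuous_bary P i : continuous (fun x => bary P x 0 i).
Proof.
move=> x; under eq_fun do rewrite baryE mxE.
by apply: continuousD; [exact: cst_continuous|exact: continuous_mulmx_coord].
Qed.

(** The affine function with value [u i 0] at each vertex [P i] differs at [P k] and [P l], so its
    linear part is nonzero and the level set is a hyperplane. *)
Lemma bary_level_null P (u : 'cV[R]_d.+1) (c : R) k l : simplex_nondeg P ->
  u k 0 != u l 0 -> lebesgue_rV R d [set x | (bary P x *m u) 0 0 = c] = 0%E.
Proof.
move=> uP ukl.
have baryPu i : (bary P (P i) *m u) 0 0 = u i 0.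
  rewrite mxE (bigD1 i)//= bary_vertex// eqxx mul1r big1 ?addr0// => k' k'i.
  by rewrite bary_vertex// eq_sym (negbTE k'i) mul0r.
have h0 : bary_lin P *m u != 0.
  apply: contra ukl => /eqP h0.
  by rewrite -!baryPu (baryE P (P k)) (baryE P (P l)) !mulmxDl -!mulmxA h0 !mulmx0.
rewrite -(lebesgue_rV_hyperplane (c - (bary P 0 *m u) 0 0) h0).
congr (lebesgue_rV R d _).
have e x : (bary P x *m u) 0 0 =
    (bary P 0 *m u) 0 0 + (x *m (bary_lin P *m u)) 0 0.
  by rewrite baryE mulmxDl mulmxA [LHS]mxE.
apply/seteqP; split => x /= h; last by rewrite e h; ring.
by rewrite -h (e x); ring.
Qed.

Definition open_simplex P : set 'rV[R]_d := [set x | forall i, 0 < bary P x 0 i].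

Lemma open_simplex_open P : open (open_simplex P).
Proof.
rewrite openE => x Px.
apply: (@filter_forall _ _ (fun i y => 0 < bary P y 0 i) (nbhs x)) => i.
have oi : open ((fun x => bary P x 0 i) @^-1` [set y : R | 0 < y]).
  by apply: open_comp; [move=> y _; exact: continuous_bary|exact: open_gt].
exact: (open_nbhs_nbhs (conj oi (Px i))).
Qed.

Definition centroid P : 'rV[R]_d := d.+1%:R^-1 *: \sum_i P i.

Lemma centroid_open_simplex P : simplex_nondeg P -> open_simplex P (centroid P).
Proof.
move=> uP i; rewrite /centroid scaler_sumr.
pose w : 'rV[R]_d.+1 := const_mx d.+1%:R^-1.
rewrite (eq_bigr (fun k => w 0 k *: P k)) => [|k _]; last by rewrite mxE.
rewrite bary_comb//; first by rewrite mxE invr_gt0.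
under eq_bigr do rewrite mxE.
by rewrite sumr_const card_ord -[LHS]mulr_natr mulVf ?pnatr_eq0.
Qed.

Lemma simplex_volume P : simplex_nondeg P ->
  (0 < lebesgue_rV R d (simplex P) < +oo)%E.
Proof.
move=> uP; apply/andP; split; last first.
  by apply: lebesgue_rV_bounded; [exact: measurable_simplex|exact: simplex_bounded].
apply: (@lt_le_trans _ _ (lebesgue_rV R d (open_simplex P))).
  apply: lebesgue_rV_open_gt0; first exact: open_simplex_open.
  by exists (centroid P); exact: centroid_open_simplex.
apply: le_measure; rewrite ?inE; last by move=> x h i; exact/ltW/h.
- by apply: open_measurable_rV; exact: open_simplex_open.
- exact: measurable_simplex.
Qed.

(* The affine map sending the vertices of [P] to those of [Q] preserves
   barycentric coordinates. *)
Lemma simplex_change P Q (F : 'rV[R]_d.+1 -> \bar R) :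
  simplex_nondeg P -> simplex_nondeg Q ->
  measurable_fun setT F -> (forall w, 0 <= F w)%E ->
  (lebesgue_rV R d (simplex Q) * \int[lebesgue_rV R d]_x F (bary P x) =
   lebesgue_rV R d (simplex P) * \int[lebesgue_rV R d]_x F (bary Q x))%E.
Proof.
move=> uP uQ mF F0; set mu := lebesgue_rV R d.
(* In homogeneous coordinates [N] takes the vertices of [P] to those of [Q]; its two right-hand
   blocks give the affine map [x *m A + b]. *)
pose N : 'M[R]_(1 + d) := invmx (vertex_mx P) *m vertex_mx Q.
pose A := drsubmx N; pose b := ursubmx N.
have LE x : x *m A + b = \sum_i bary P x 0 i *: Q i.
  have : cons_rV (1, x) *m N = cons_rV (1, \sum_i bary P x 0 i *: Q i).
    by rewrite mulmxA mulmx_vertex_mx (bary_sum x uP).1.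
  rewrite -[N in LHS]submxK /cons_rV /= (mul_row_block 1%:M x) !mul1mx.
  by move=> /eq_row_mx[_ <-]; rewrite addrC.
have baryL x : bary Q (x *m A + b) = bary P x.
  by rewrite LE bary_comb//; exact: (bary_sum x uP).1.
have uA : A \in unitmx.
  rewrite -row_free_unit; apply: inj_row_free => v vA.
  rewrite -(bary_sum v uP).2 -[RHS](bary_sum 0 uP).2.
  by apply: eq_bigr => i _; rewrite -!baryL vA mul0mx.
have change (G H : 'rV[R]_d.+1 -> \bar R) :
    measurable_fun setT G -> (forall w, 0 <= G w)%E ->
    measurable_fun setT H -> (forall w, 0 <= H w)%E ->
    ((\int[mu]_x G (bary P x)) * (\int[mu]_x H (bary Q x)) =
     (\int[mu]_x G (bary Q x)) * (\int[mu]_x H (bary Q (- (x *m A))%R)))%E.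
  move=> mG G0 mH H0.
  have mGQ : measurable_fun setT (fun x => G (bary Q x)).
    exact: measurableT_comp (measurable_bary Q).
  rewrite -(ge0_integral_rV_shift b mGQ)//.
  have mH' : measurable_fun setT (fun x => H (bary Q x)).
    exact: measurableT_comp (measurable_bary Q).
  have mGb := measurableT_comp mGQ (measurable_shift_rV b).
  have /= <-// := ge0_integral_rV_mulmx uA mGb _ mH' _.
  by congr (_ * _)%E; apply: eq_integral => x _ /=; rewrite baryL.
(* The indicator of the nonnegative orthant; composed with [bary S] it is the indicator of
   [simplex S]. *)
pose I (w : 'rV[R]_d.+1) : \bar R :=
  (\1_[set w : 'rV[R]_d.+1 | forall i, 0 <= w 0 i] w)%:E.
have mI : measurable_fun setT I.
  by apply/measurable_EFinP; apply: measurable_indic; exact: measurable_orthant.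
have I0 w : (0 <= I w)%E by rewrite lee_fin.
have volE S : (\int[mu]_x I (bary S x) = mu (simplex S))%E.
  transitivity (\int[mu]_x (\1_(simplex S) x)%:E)%E; first exact: eq_integral.
  by rewrite integral_indic ?setIT//; exact: measurable_simplex.
(* Both instances of [change] contain the same unknown factor [c]. The one for [I] alone shows that
   [c] is the volume of [P]; the one for [F] is then the claim. *)
have := change F I mF F0 mI I0; have := change I I mI I0 mI I0; rewrite !volE.
have /andP[vQ0 vQy] := simplex_volume uQ.
set c := (\int[mu]_x I _)%E => e1 e2.
have vQ : mu (simplex Q) \is a fin_num by rewrite ge0_fin_numE.
have -> : mu (simplex P) = c.
  by apply: (inc_inj (lee_pmul2l vQ vQ0)); rewrite -e1 muleC.
by rewrite muleC e2 muleC.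
Qed.

End barycentric.

(** * Integrals of functions of the barycentric coordinates *)

Section simplex_integrals.
Context {R : realType} {d : nat}.
Implicit Types (P : 'I_d.+1 -> 'rV[R]_d) (F : 'rV[R]_d.+1 -> R).
Local Notation mu := (lebesgue_rV R d).

Lemma vol_simplex_gt0 P : simplex_nondeg P -> 0 < vol (simplex P).
Proof. by move=> /simplex_volume vP; rewrite /vol fine_gt0. Qed.

Lemma volE P : simplex_nondeg P -> (vol (simplex P))%:E = mu (simplex P).
Proof.
by move=> /simplex_volume/andP[/ltW v0 vy]; rewrite /vol fineK// ge0_fin_numE.
Qed.

(** The upper bound is asked for on the unit cube only, where the barycentric coordinates of points
    of the simplex lie; products of coordinates are unbounded on the orthant. *)
Definition barycentric_bounded F := [/\ measurable_fun setT F,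
  (forall w : 'rV[R]_d.+1, (forall i, 0 <= w 0 i) -> 0 <= F w) &
  exists M, forall w : 'rV[R]_d.+1, (forall i, 0 <= w 0 i <= 1) -> F w <= M].

Lemma integrable_bary P F : simplex_nondeg P -> barycentric_bounded F ->
  mu.-integrable (simplex P) (EFin \o (fun x => F (bary P x))).
Proof.
move=> uP [mF F0 [M FM]]; apply: measurable_bounded_integrable.
- exact: measurable_simplex.
- by have /andP[] := simplex_volume uP.
- apply: measurable_funTS; exact: measurableT_comp (measurable_bary P).
- exists M; split; first exact: num_real.
  move=> N MN x Px; rewrite /= ger0_norm; last exact: F0.
  by apply: le_trans (ltW MN); apply: FM => i; exact: simplex_bary_le1.
Qed.

(** Cutting [F] off outside the orthant turns the integrals over the whole space in [simplex_change]
    into integrals over the simplices, which are finite. *)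
Lemma Rsimplex_change P Q F : simplex_nondeg P -> simplex_nondeg Q ->
  barycentric_bounded F ->
  vol (simplex Q) * \int[mu]_(x in simplex P) F (bary P x) =
  vol (simplex P) * \int[mu]_(x in simplex Q) F (bary Q x).
Proof.
move=> uP uQ bF; have [mF F0 _] := bF.
pose D := [set w : 'rV[R]_d.+1 | forall i, 0 <= w 0 i].
pose G w : \bar R := ((F \_ D) w)%:E.
have mG : measurable_fun setT G.
  apply/measurable_EFinP/(measurable_restrictT _ measurable_orthant).
  exact: measurable_funTS.
have G0 w : (0 <= G w)%E.
  by rewrite lee_fin patchE; case: ifPn => // /set_mem; exact: F0.
have GE S : (\int[mu]_x G (bary S x) =
             \int[mu]_(x in simplex S) (F (bary S x))%:E)%E.
  rewrite [RHS]integral_mkcond; apply: eq_integral => x _.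
  rewrite /G !patchE; case: ifPn => [xD|xD].
    by rewrite ifT// inE; exact/set_mem.
  by rewrite ifN// notin_setE; move: xD; rewrite notin_setE.
have := simplex_change uP uQ mG G0; rewrite !GE -!volE// /Rintegral => e.
have fin S : simplex_nondeg S ->
    (\int[mu]_(x in simplex S) (F (bary S x))%:E)%E \is a fin_num.
  move=> uS; apply: integrable_fin_num; first exact: measurable_simplex.
  exact: integrable_bary.
rewrite -[vol (simplex Q)]/(fine (vol (simplex Q))%:E) -fineM ?fin// e.
by rewrite fineM ?fin.
Qed.

Lemma simplex_perm P (s : {perm 'I_d.+1}) : simplex_nondeg P ->
  simplex (P \o s) = simplex P.
Proof.
move=> uP; apply/seteqP; split => x h i; last first.
  by rewrite (bary_perm s x i uP).2; exact: h.
by have := h (s^-1 i)%g; rewrite (bary_perm s x _ uP).2 permKV.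
Qed.

(** Renumbering the vertices leaves the simplex unchanged, so the two volumes in [Rsimplex_change]
    are equal and cancel. *)
Lemma simplex_integral_perm P F (s : {perm 'I_d.+1}) : simplex_nondeg P ->
  barycentric_bounded F ->
  \int[mu]_(x in simplex P) F (bary P x) =
  \int[mu]_(x in simplex P) F (\row_i bary P x 0 (s i)).
Proof.
move=> uP bF; have us := (bary_perm s 0 ord0 uP).1.
have := Rsimplex_change uP us bF; rewrite simplex_perm//.
move=> /(mulfI (lt0r_neq0 (vol_simplex_gt0 uP))) ->.
apply: eq_Rintegral => x _; congr F; apply/rowP => i.
by rewrite mxE (bary_perm s x i uP).2.
Qed.

Lemma barycentric_boundedM i j :
  barycentric_bounded (fun w : 'rV[R]_d.+1 => w 0 i * w 0 j).
Proof.
split; first by apply: measurable_funM; exact: measurable_rV_coord.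
- by move=> w w0; rewrite mulr_ge0.
- exists 1 => w w01; have /andP[? ?] := w01 i; have /andP[? ?] := w01 j.
  by rewrite mulr_ile1.
Qed.

Lemma barycentric_bounded_patch (D : set 'rV[R]_d.+1) F : measurable D ->
  barycentric_bounded F -> barycentric_bounded (F \_ D).
Proof.
move=> mD [mF F0 [M FM]]; split.
- by apply/(measurable_restrictT _ mD); exact: measurable_funTS.
- by move=> w w0; rewrite patchE; case: ifP => // _; exact: F0.
- exists (Num.max M 0) => w w01; rewrite patchE le_max; case: ifP => _.
    by rewrite FM.
  by rewrite lexx orbT.
Qed.

Definition moment P i j :=
  \int[mu]_(x in simplex P) (bary P x 0 i * bary P x 0 j).

Lemma moment_perm P (s : {perm 'I_d.+1}) i j : simplex_nondeg P ->
  moment P i j = moment P (s i) (s j).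
Proof.
move=> uP; rewrite /moment (simplex_integral_perm s uP (barycentric_boundedM i j)).
by apply: eq_Rintegral => x _; rewrite !mxE.
Qed.

Lemma moment_diag P i j : simplex_nondeg P -> moment P i i = moment P j j.
Proof. by move=> uP; rewrite (moment_perm (tperm i j))// tpermL. Qed.

(** Two transpositions suffice: the first sends [i] to [k] and [j] to some [j'] distinct from [k],
    the second sends [j'] to [l] and fixes [k]. *)
Lemma moment_offdiag P i j k l : simplex_nondeg P -> i != j -> k != l ->
  moment P i j = moment P k l.
Proof.
move=> uP ij kl; rewrite (moment_perm (tperm i k))// tpermL.
set j' := tperm i k j.
have kj' : k != j' by rewrite -[k](tpermL i) (inj_eq perm_inj).
by rewrite (moment_perm (tperm j' l))// tpermL tpermD // eq_sym.
Qed.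

(** The products of all pairs of barycentric coordinates add up to the square of their sum, which is
    1. *)
Lemma moment_sum P : simplex_nondeg P ->
  \sum_i \sum_j moment P i j = vol (simplex P).
Proof.
move=> uP.
have iM i j : mu.-integrable (simplex P)
    (EFin \o (fun x => bary P x 0 i * bary P x 0 j)).
  exact: (integrable_bary uP (barycentric_boundedM i j)).
have mP : measurable (simplex P) by exact: measurable_simplex.
under eq_bigr do rewrite -Rintegral_sum//.
rewrite -Rintegral_sum//; last by move=> i; exact: integrable_Rsum.
rewrite -[RHS]mul1r -Rintegral_cst//; apply: eq_Rintegral => x _.
have [s1 _] := bary_sum x uP.
by under eq_bigr do rewrite -mulr_sumr s1 mulr1; rewrite s1.
Qed.

(** * Bisection of a simplex at the midpoint of an edge *)

Section bisection.
Variables (P : 'I_d.+1 -> 'rV[R]_d) (i j : 'I_d.+1).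
Hypotheses (uP : simplex_nondeg P) (ij : i != j).

(** The half of the simplex on the side of [P i]: the midpoint of the edge replaces [P j]. *)
Let Q k := if k == j then 2^-1 *: (P i + P j) else P k.

(* Barycentric coordinates with respect to [P] in terms of those for [Q]. *)
Let up (w : 'rV[R]_d.+1) : 'rV[R]_d.+1 :=
  \row_k if k == j then w 0 j / 2 else if k == i then w 0 i + w 0 j / 2 else w 0 k.

Let upE w k : up w 0 k =
  if k == j then w 0 j / 2 else if k == i then w 0 i + w 0 j / 2 else w 0 k.
Proof. by rewrite mxE. Qed.

Let sum_if (V : lmodType R) (F : 'I_d.+1 -> V) :
  \sum_k F k = F i + F j + \sum_(k | (k != i) && (k != j)) F k.
Proof. by rewrite (bigD1 i)//= (bigD1 j) 1?eq_sym//= addrA. Qed.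

Let up_sum w : \sum_k up w 0 k = \sum_k w 0 k.
Proof.
rewrite (sum_if (fun k => up w 0 k : R^o)) (sum_if (fun k => w 0 k : R^o)).
congr (_ + _).
  by rewrite !mxE eqxx (negbTE ij) eqxx -addrA -splitr.
by apply: eq_bigr => k /andP[ki kj]; rewrite mxE (negbTE ki) (negbTE kj).
Qed.

Let up_comb w : \sum_k up w 0 k *: P k = \sum_k w 0 k *: Q k.
Proof.
rewrite !sum_if; congr (_ + _).
  by rewrite /Q !mxE eqxx (negbTE ij) eqxx scalerA scalerDr scalerDl !addrA.
by apply: eq_bigr => k /andP[ki kj]; rewrite /Q mxE (negbTE ki) (negbTE kj).
Qed.

Let Q_nondeg : simplex_nondeg Q.
Proof.
apply: simplex_nondegP => w w0 wQ0.
have w'0 : up w = 0.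
  have : up w *m vertex_mx P = 0 *m vertex_mx P.
    rewrite !mulmx_vertex_mx up_sum up_comb w0 wQ0.
    congr (cons_rV (_, _)); rewrite big1// => k _; rewrite mxE ?scale0r//.
  by move=> /(congr1 (mulmx^~ (invmx (vertex_mx P)))); rewrite !mulmxK.
have wj : w 0 j = 0.
  by have /rowP/(_ j) := w'0; rewrite !mxE eqxx; lra.
apply/rowP => k; have /rowP/(_ k) := w'0; rewrite !mxE wj.
case: (eqVneq k j) => [->//|_]; case: (eqVneq k i) => [->|//].
by rewrite mul0r addr0.
Qed.

Let baryQ x : bary P x = up (bary Q x).
Proof.
have [s1 sx] := bary_sum x Q_nondeg.
by rewrite -[X in bary P X]sx -up_comb bary_comb// up_sum.
Qed.

Let half k l : set 'rV[R]_d.+1 := [set w | w 0 k <= w 0 l].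

Let measurable_half k l : measurable (half k l).
Proof.
have mc m : measurable_fun setT (fun w : 'rV[R]_d.+1 => w 0 m).
  exact: measurable_rV_coord.
have := measurable_fun_ler (mc k) (mc l) measurableT (Y := [set true]).
by rewrite setTI; exact.
Qed.

(** By [up], the coordinates [i] and [j] with respect to [P] differ by the coordinate [i] with
    respect to [Q], so its sign decides the half. *)
Let simplexQ : simplex Q = simplex P `&` [set x | half j i (bary P x)].
Proof.
apply/seteqP; split => x.
  move=> Qx; split => [k|]; rewrite ?/half/= baryQ !upE.
    by case: (k == j); [|case: (k == i)]; rewrite ?addr_ge0 ?divr_ge0//; exact: Qx.
  by rewrite eqxx (negbTE ij) eqxx lerDr; exact: Qx.
move=> [Px]; rewrite /half/= baryQ !upE eqxx (negbTE ij) eqxx lerDr => Qi k.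
have := Px k; rewrite baryQ upE; case: (eqVneq k j) => [->|_]; first lra.
by case: (eqVneq k i) => [->|].
Qed.

Let half_patch F :
  \int[mu]_(x in simplex P) (F \_ (half j i)) (bary P x) =
  \int[mu]_(x in simplex Q) F (up (bary Q x)).
Proof.
rewrite simplexQ Rintegral_mkcondr; apply: eq_Rintegral => x _.
by rewrite !patchE -baryQ.
Qed.

Let half_swap F : barycentric_bounded F ->
  (forall w : 'rV[R]_d.+1, F (\row_k w 0 (tperm i j k)) = F w) ->
  \int[mu]_(x in simplex P) (F \_ (half j i)) (bary P x) =
  \int[mu]_(x in simplex P) (F \_ (half i j)) (bary P x).
Proof.
move=> bF Fsym; have bFh := barycentric_bounded_patch (measurable_half j i) bF.
rewrite (simplex_integral_perm (tperm i j) uP bFh); apply: eq_Rintegral => x _.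
rewrite !patchE Fsym; congr (if _ then _ else _).
by apply/idP/idP => /set_mem h; apply/mem_set; move: h;
  rewrite /half/= ![(\row_k _) _ _]mxE tpermL tpermR.
Qed.

(** Swapping [i] and [j] exchanges the two halves, so both contribute the same, and one of them is
    [simplex Q]. On the left, points common to both halves are counted twice. *)
Let half_sum F : barycentric_bounded F ->
  (forall w : 'rV[R]_d.+1, F (\row_k w 0 (tperm i j k)) = F w) ->
  \int[mu]_(x in simplex P)
    ((F \_ (half j i)) (bary P x) + (F \_ (half i j)) (bary P x)) =
  2 * \int[mu]_(x in simplex Q) F (up (bary Q x)).
Proof.
move=> bF Fsym; rewrite RintegralD//.
- by rewrite -half_swap// half_patch; ring.
- exact: measurable_simplex.
- exact/integrable_bary/barycentric_bounded_patch.
- exact/integrable_bary/barycentric_bounded_patch.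
Qed.

(** This is [half_sum] for the constant 1, once the overlap of the two halves is known to be a null
    set. *)
Let vol_bisect : vol (simplex P) = 2 * vol (simplex Q).
Proof.
pose F (w : 'rV[R]_d.+1) : R := 1.
have bF : barycentric_bounded F.
  by split=> [|w _|]; [exact: measurable_cst|exact: ler01|exists 1].
have mP := measurable_simplex P; have mQ := measurable_simplex Q.
pose E := [set x | bary P x 0 i = bary P x 0 j].
have E0 : mu E = 0%E.
  (* Vertex values 1 at [P i], -1 at [P j] and 0 elsewhere: the zero set of this affine function is
     [E]. *)
  pose u : 'cV[R]_d.+1 := \col_k ((k == i)%:R - (k == j)%:R).
  have uij : u i 0 != u j 0.
    rewrite !mxE !eqxx [j == i]eq_sym (negbTE ij) subr0 sub0r.
    by rewrite -subr_eq0 opprK -(natrD _ 1 1) pnatr_eq0.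
  rewrite -(bary_level_null 0 uP uij); congr (mu _).
  have uE (w : 'rV[R]_d.+1) : (w *m u) 0 0 = w 0 i - w 0 j.
    rewrite mxE; under eq_bigr do rewrite mxE mulrBr.
    rewrite sumrB (bigD1 i)//= big1 => [|k /negbTE ->]; last by rewrite mulr0.
    rewrite [X in _ - X](bigD1 j)//=.
    rewrite [X in _ - (_ + X)]big1 => [|k /negbTE ->]; last by rewrite mulr0.
    by rewrite !eqxx !mulr1 !addr0.
  apply/seteqP; split => x /=; rewrite uE; last by move/subr0_eq.
  by move=> ->; rewrite subrr.
have mE : measurable E.
  have := measurable_fun_eqr (measurable_bary_coord P i) (measurable_bary_coord P j)
    measurableT (Y := [set true]).
  rewrite setTI => /(_ I); congr (measurable _).
  by apply/seteqP; split => x /= /eqP.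
pose diag := half i j `&` half j i.
have bFd : barycentric_bounded (F \_ diag).
  by apply: barycentric_bounded_patch => //; exact: measurableI.
have diag0 : \int[mu]_(x in simplex P) (F \_ diag) (bary P x) = 0.
  transitivity (\int[mu]_(x in simplex P `&` E) 1).
    rewrite Rintegral_mkcondr; apply: eq_Rintegral => x _; rewrite !patchE.
    congr (if _ then _ else _); apply/idP/idP => /set_mem h; apply/mem_set.
      by case: h; rewrite /half/= => ? ?; apply/le_anti/andP.
    by rewrite /diag /half /= h.
  rewrite Rintegral_cst; last exact: measurableI.
  rewrite mul1r; apply: (congr1 fine (y := 0%E)).
  by apply: (subset_measure0 _ mE) => //; exact: measurableI.
have := half_sum bF (fun=> erefl); rewrite Rintegral_cst// mul1r => <-.
rewrite (_ : vol _ = \int[mu]_(x in simplex P) F (bary P x)); last first.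
  by rewrite Rintegral_cst// mul1r.
rewrite -[LHS]addr0 -diag0 -RintegralD//; last 2 first.
  exact: integrable_bary.
  exact: integrable_bary.
apply: eq_Rintegral => x _; rewrite !patchE /diag in_setI.
have [h|h] := leP (bary P x 0 i) (bary P x 0 j).
  by rewrite (mem_set (A := half i j))//= addrC.
have h' : half j i (bary P x) by exact: ltW.
rewrite (mem_set h') andbT ifN ?addr0//.
by rewrite notin_setE /half /= => /le_lt_trans/(_ h); rewrite ltxx.
Qed.

(** The mean of a product of coordinates is the same over [P] and [Q], and [Q] has half the
    volume. *)
Let moment_bisect k l : moment P k l = 2 * moment Q k l.
Proof.
have := Rsimplex_change uP Q_nondeg (barycentric_boundedM k l).
rewrite vol_bisect mulrAC mulrC => e.
by apply: (mulIf (lt0r_neq0 (vol_simplex_gt0 Q_nondeg))); rewrite -e.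
Qed.

Lemma moment_offdiag_le : 2 * moment P i j <= moment P j j.
Proof.
have bM := barycentric_boundedM i j.
have bP k l := integrable_bary uP (barycentric_boundedM k l).
have bQ k l := integrable_bary Q_nondeg (barycentric_boundedM k l).
have mP := measurable_simplex P; have mQ := measurable_simplex Q.
have ipatch k l :=
  integrable_bary uP (barycentric_bounded_patch (measurable_half k l) bM).
have sym (w : 'rV[R]_d.+1) :
    (\row_k w 0 (tperm i j k)) 0 i * (\row_k w 0 (tperm i j k)) 0 j =
    w 0 i * w 0 j.
  by rewrite !mxE tpermL tpermR mulrC.
(* Counting the overlap of the halves twice only increases the integral. In the coordinates [w] for
   [Q] the integrand is [(w_i + w_j/2) (w_j/2)], and twice this is [w_i w_j + w_j^2 / 2]. *)
have : moment P i j <= moment Q i j + moment Q j j / 2.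
  rewrite (_ : _ + _ = 2 * \int[mu]_(x in simplex Q)
      (up (bary Q x) 0 i * up (bary Q x) 0 j)).
    rewrite -(half_sum bM sym); apply: le_Rintegral => //.
    - exact: (integrableD mP (ipatch j i) (ipatch i j)).
    - move=> x Px; rewrite !patchE.
      have xij : 0 <= bary P x 0 i * bary P x 0 j by rewrite mulr_ge0 ?Px.
      have [h|h] := leP (bary P x 0 j) (bary P x 0 i).
        rewrite mem_set// lerDl; by case: ifP.
      by rewrite [X in _ + X]ifT ?lerDr; [case: ifP|apply/mem_set/ltW].
  rewrite (_ : \int[mu]_(x in simplex Q) _ = \int[mu]_(x in simplex Q)
      (2^-1 * (bary Q x 0 i * bary Q x 0 j) +
       4^-1 * (bary Q x 0 j * bary Q x 0 j))).
    rewrite RintegralD//; last 2 first.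
    - exact: (integrableZl _ (2^-1) (bQ i j)).
    - exact: (integrableZl _ (4^-1) (bQ j j)).
    rewrite RintegralZl//.
    rewrite RintegralZl//.
    by rewrite -!/(moment _ _ _); lra.
  apply: eq_Rintegral => x _; rewrite !upE eqxx (negbTE ij) eqxx.
  by field; rewrite ?pnatr_eq0.
rewrite (moment_bisect i j) (moment_bisect j j); lra.
Qed.

End bisection.

(** With [p] the off-diagonal moment, each of the [d+1] rows of the moment matrix consists of a
    diagonal entry, at least [2 p], and of [d] entries [p]; all entries together add up to the
    volume. *)
Lemma moment_offdiag_vol P i j : simplex_nondeg P -> i != j ->
  moment P i j * (d.+1%:R * d.+2%:R) <= vol (simplex P).
Proof.
move=> uP ij; rewrite -moment_sum//.
have : \sum_(k < d.+1) (2 * moment P i j + d%:R * moment P i j) <=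
    \sum_k \sum_l moment P k l.
  apply: ler_sum => k _; rewrite (bigD1 k)//= lerD//.
    by rewrite (moment_diag k j)// moment_offdiag_le.
  rewrite (eq_bigr (fun=> moment P i j)) => [|l lk]; last first.
    by apply: moment_offdiag => //; rewrite eq_sym.
  by rewrite sumr_const cardC1 card_ord mulr_natl.
apply: le_trans; rewrite sumr_const card_ord -[leRHS]mulr_natl.
rewrite le_eqVlt -[d.+2%:R]natr1 -[d.+1%:R]natr1.
by apply/orP; left; apply/eqP; ring.
Qed.

End simplex_integrals.

(** * The mesh and its nodal basis *)

Lemma derive_affine (R : realType) (n : nat) (c : R) (b : 'cV[R]_n)
    (a v : 'rV[R]_n) :
  'D_v (fun x : 'rV[R]_n => c + (x *m b) 0 0) a = (v *m b) 0 0.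
Proof.
apply: cvg_lim => //; apply: cvg_near_cst; near=> h.
have h0 : h != 0 by near: h; exact: nbhs_dnbhs_neq.
rewrite /= opprD addrACA subrr add0r mulmxDl -scalemxAl.
by rewrite [X in X - _]mxE [X in X + _ - _]mxE addrK [_ *: _]mulrA mulVf// mul1r.
Unshelve. all: by end_near. Qed.

Lemma grad_affine (R : realType) (n : nat) (f : 'rV[R]_n -> R) (c : R)
    (b : 'cV[R]_n) (a : 'rV[R]_n) :
  (\forall x \near a, f x = c + (x *m b) 0 0) -> grad f a = b.
Proof.
move=> fE; apply/colP => k; rewrite mxE.
rewrite (near_eq_derive _ fE) derive_affine mxE (bigD1 k)//= big1 => [|l lk].
  by rewrite mxE !eqxx mul1r addr0.
by rewrite mxE (negbTE lk) mul0r.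
Qed.

Section mesh_elements.
Context {R : realType} {d : nat} (Omega : set 'rV[R]_d) (m : mesh R d).
Context (phi : 'I_(nvert m) -> 'rV[R]_d -> R).
Hypotheses (hm : triangulation Omega m) (hphi : nodal_basis Omega phi).
Implicit Types K L : {set 'I_(nvert m)}.
Local Notation mu := (lebesgue_rV R d).

(** For an element this is the open simplex, near each point of which every [phi j] is affine. *)
Definition open_hull K : set 'rV[R]_d :=
  [set x | exists w : 'I_(nvert m) -> R,
    [/\ forall i, i \in K -> 0 < w i, \sum_(i in K) w i = 1 &
        x = \sum_(i in K) w i *: vertex i]].

(** A local numbering of the vertices, which makes the results on simplices available for
    elements. *)
Lemma element_enum K : #|K| = d.+1 ->
  exists2 e : 'I_d.+1 -> 'I_(nvert m), injective e & K = [set e k | k : 'I_d.+1].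
Proof.
move=> cK; exists (fun k => enum_val (cast_ord (esym cK) k)).
  by move=> k l /enum_val_inj/cast_ord_inj.
apply/setP => i; apply/idP/imsetP => [iK|[k _ ->]]; last exact: enum_valP.
by exists (cast_ord cK (enum_rank_in iK i)); rewrite ?cast_ordK ?enum_rankK_in.
Qed.

Section numbering.
Variables (K : {set 'I_(nvert m)}) (e : 'I_d.+1 -> 'I_(nvert m)).
Hypotheses (Km : K \in elements m) (e_inj : injective e)
  (KE : K = [set e k | k : 'I_d.+1]).

Local Notation P := (fun k => vertex (e k)).

Lemma big_element (V : nmodType) (F : 'I_(nvert m) -> V) :
  \sum_(i in K) F i = \sum_k F (e k).
Proof. by rewrite KE big_imset//= => k l _ _ /e_inj. Qed.

Lemma weight_element (w : 'rV[R]_d.+1) :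
  exists v : 'I_(nvert m) -> R, forall k, v (e k) = w 0 k.
Proof.
exists (fun i => \sum_(k | e k == i) w 0 k) => k.
by rewrite (big_pred1 k)// => l; rewrite /= (inj_eq e_inj).
Qed.

Lemma mem_element k : e k \in K.
Proof. by rewrite KE; apply/imsetP; exists k. Qed.

Lemma element_simplex_nondeg : simplex_nondeg P.
Proof.
apply: simplex_nondegP => w w0 wP0; have [v vE] := weight_element w.
apply/rowP => k; rewrite mxE -vE.
apply: (element_nondegenerate hm Km); last exact: mem_element.
  by rewrite big_element; under eq_bigr do rewrite vE.
by rewrite big_element; under eq_bigr do rewrite vE.
Qed.

Let uP := element_simplex_nondeg.

(** The predicate [p] covers both the closed element ([0 <= r]) and the open one ([0 < r]). *)
Lemma element_weights (p : pred R) :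
  [set x | exists w : 'I_(nvert m) -> R,
    [/\ forall i, i \in K -> p (w i), \sum_(i in K) w i = 1 &
        x = \sum_(i in K) w i *: vertex i]] =
  [set x | forall k, p (bary P x 0 k)].
Proof.
apply/seteqP; split => x /=.
  move=> [v [vp v1 ->]] k; rewrite big_element.
  pose w : 'rV[R]_d.+1 := \row_k v (e k).
  rewrite (eq_bigr (fun k => w 0 k *: P k)) => [|l _]; last by rewrite mxE.
  rewrite bary_comb// ?mxE ?vp ?mem_element//.
  by under eq_bigr do rewrite mxE; rewrite -big_element.
move=> Px; have [v vE] := weight_element (bary P x).
have [s1 sx] := bary_sum x uP; exists v; split.
- by move=> i; rewrite KE => /imsetP[k _ ->]; rewrite vE; exact: Px.
- by rewrite big_element; under eq_bigr do rewrite vE.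
- by rewrite big_element; under eq_bigr do rewrite vE.
Qed.

Lemma hull_simplex : hull K = simplex P.
Proof. exact: (element_weights (fun r => 0 <= r)). Qed.

Lemma open_hull_simplex : open_hull K = open_simplex P.
Proof. exact: (element_weights (fun r => 0 < r)). Qed.

Lemma barycenter_centroid : barycenter K = centroid P.
Proof. by rewrite /barycenter /centroid big_element KE card_imset// card_ord. Qed.

(** The values of [phi j] at the vertices of [K]: a unit vector if [j] belongs to [K], zero
    otherwise. *)
Let node j : 'cV[R]_d.+1 := \col_k (e k == j)%:R.

(** On a simplex an affine function is the barycentric combination of its vertex values. *)
Lemma phi_bary j x : hull K x -> phi j x = (bary P x *m node j) 0 0.
Proof.
move=> Kx; have [b [c phiE]] := phi_linear hphi j Km.
have [s1 sx] := bary_sum x uP.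
rewrite phiE// -[x in LHS]sx mulmx_suml summxE.
rewrite -[c]mul1r -[in X in _ + X]s1 mulr_suml -big_split mxE; apply: eq_bigr => k _ /=.
rewrite -scalemxAl [X in X + _]mxE -mulrDr -phiE; last first.
  by rewrite hull_simplex => l; rewrite bary_vertex.
by rewrite (phi_vertex hphi) [in RHS]/node [X in _ = _ * X]mxE.
Qed.

Lemma phi_bary_coord n x : hull K x -> phi (e n) x = bary P x 0 n.
Proof.
move=> Kx; rewrite phi_bary// mxE (bigD1 n)//= big1 => [|n' n'n].
  by rewrite [node _ _ _]mxE eqxx mulr1 addr0.
by rewrite [node _ _ _]mxE (inj_eq e_inj) (negbTE n'n) mulr0.
Qed.

Lemma grad_bary j x : open_hull K x -> grad (phi j) x = bary_lin P *m node j.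
Proof.
move=> Kx; apply: (@grad_affine _ _ _ ((bary P 0 *m node j) 0 0)).
have : \forall y \near x, open_hull K y.
  apply: open_nbhs_nbhs; split=> //.
  by rewrite open_hull_simplex; exact: open_simplex_open.
apply: filterS => y Ky; rewrite phi_bary.
  by rewrite baryE mulmxDl mulmxA mxE.
by rewrite hull_simplex => k; move: Ky; rewrite open_hull_simplex => /(_ k)/ltW.
Qed.

(** The vectors [node j] add up to the all-ones vector, so the sum is the gradient of the sum of the
    barycentric coordinates, a constant. *)
Lemma sum_grad_bary : \sum_j bary_lin P *m node j = 0.
Proof.
rewrite -mulmx_sumr.
have -> : \sum_j node j = const_mx 1.
  apply/colP => k; rewrite summxE (bigD1 (e k))//= big1 => [|j jk].
    by rewrite !mxE eqxx addr0.
  by rewrite mxE eq_sym (negbTE jk).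
have s1 x : (bary P x *m (const_mx 1 : 'cV[R]_d.+1)) 0 0 = 1.
  rewrite mxE; under eq_bigr do rewrite [const_mx _ _ _]mxE mulr1.
  exact: (bary_sum x uP).1.
apply/colP => k; have := s1 (delta_mx 0 k).
rewrite baryE mulmxDl mxE s1 -mulmxA -rowE => /eqP.
by rewrite -subr_eq0 addrAC subrr add0r mxE => /eqP ->; rewrite mxE.
Qed.

Lemma node0 j : j \notin K -> node j = 0.
Proof.
move=> jK; apply/colP => k; rewrite !mxE; case: eqP => // ekj.
by move: jK; rewrite -ekj mem_element.
Qed.

Lemma measurable_hull_open_hull : measurable (hull K) /\ measurable (open_hull K).
Proof.
rewrite hull_simplex open_hull_simplex; split; first exact: measurable_simplex.
by apply: open_measurable_rV; exact: open_simplex_open.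
Qed.

Lemma hull_boundary_null : (0 < d)%N -> mu (hull K `\` open_hull K) = 0%E.
Proof.
move=> d0; have [mK moK] := measurable_hull_open_hull.
pose F k := [set x | (bary P x *m (delta_mx k 0 : 'cV[R]_d.+1)) 0 0 = 0].
have [mF F0] : measurable (\big[setU/set0]_(k < d.+1) F k) /\
    mu (\big[setU/set0]_(k < d.+1) F k) = 0%E.
  apply: null_bigsetU => k _; split.
    have := measurableT_comp (measurable_mulmx_coord (delta_mx k 0 : 'cV[R]_d.+1) 0)
      (measurable_bary P) measurableT (measurable_set1 0).
    by rewrite setTI.
  (* Since [d > 0] there is a second vertex, where coordinate [k] is 0 rather than 1; its zero set
     is therefore a hyperplane. *)
  have [l lk] : exists l : 'I_d.+1, l != k.
    have [->|k0] := eqVneq k ord0; last by exists ord0; rewrite eq_sym.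
    by exists ord_max; rewrite -val_eqE /= -lt0n.
  apply: (bary_level_null (k := k) (l := l) _ uP).
  by rewrite !mxE !eqxx (negbTE lk) oner_eq0.
apply: (subset_measure0 _ mF) => //; first exact: measurableD.
rewrite hull_simplex open_hull_simplex => x [Px /existsNP[k /negP]].
rewrite -leNgt => xk; rewrite -bigcup_seq.
exists k; first by rewrite /= mem_index_enum.
by rewrite /F/= -colE mxE; apply/le_anti; rewrite xk Px.
Qed.

End numbering.

End mesh_elements.

(** * Integrals over the domain, element by element *)

Section mesh_integrals.
Context {R : realType} {d : nat} (Omega : set 'rV[R]_d) (m : mesh R d).
Context (phi : 'I_(nvert m) -> 'rV[R]_d -> R).
Hypotheses (d_gt0 : (0 < d)%N) (hm : triangulation Omega m)
  (hphi : nodal_basis Omega phi) (oOmega : open Omega) (bOmega : bounded_set Omega).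
Implicit Types K L : {set 'I_(nvert m)}.
Local Notation mu := (lebesgue_rV R d).

Lemma measurable_domain : measurable Omega.
Proof. exact: open_measurable_rV. Qed.

Lemma measurable_elements K : K \in elements m ->
  measurable (hull K) /\ measurable (open_hull K).
Proof.
move=> Km; have [e e_inj KE] := element_enum (element_card hm Km).
exact: (measurable_hull_open_hull hm Km e_inj KE).
Qed.

Lemma open_hull_sub K : open_hull K `<=` hull K.
Proof.
by move=> x [w [w0 w1 xE]]; exists w; split => // i iK; exact/ltW/w0.
Qed.

Lemma open_hull_open K : K \in elements m -> open (open_hull K).
Proof.
move=> Km; have [e e_inj KE] := element_enum (element_card hm Km).
rewrite (open_hull_simplex hm Km e_inj KE); exact: open_simplex_open.
Qed.

Lemma barycenter_open_hull K : K \in elements m -> open_hull K (barycenter K).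
Proof.
move=> Km; have [e e_inj KE] := element_enum (element_card hm Km).
rewrite (open_hull_simplex hm Km e_inj KE) (barycenter_centroid e_inj KE).
exact/centroid_open_simplex/(element_simplex_nondeg hm Km e_inj KE).
Qed.

Lemma vol_hull_gt0 K : K \in elements m -> 0 < vol (hull K).
Proof.
move=> Km; have [e e_inj KE] := element_enum (element_card hm Km).
rewrite (hull_simplex hm Km e_inj KE).
exact/vol_simplex_gt0/(element_simplex_nondeg hm Km e_inj KE).
Qed.

Lemma hull_closure K : K \in elements m -> hull K `<=` closure Omega.
Proof. by move=> Km x Kx; rewrite (elements_cover hm); exists K. Qed.

(** By conformity a common interior point is a combination of the shared vertices alone. Uniqueness
    of barycentric coordinates then gives weight zero to any vertex of one element missing from the
    other, against strict positivity. *)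
Lemma open_hull_disjoint K L x : K \in elements m -> L \in elements m ->
  open_hull K x -> open_hull L x -> K = L.
Proof.
move=> Km Lm Kx Lx.
suff sub K' L' : K' \in elements m -> L' \in elements m ->
    open_hull K' x -> open_hull L' x -> K' \subset L'.
  by apply/eqP; rewrite finset.eqEsubset !sub.
move=> {K L}Km {}Lm {}Kx {}Lx; apply/fintype.subsetP => i iK.
apply: contrapT => /negP iL.
have [v [v0 v1 xv]] := Kx.
have [w [w0 w1 xw]] : hull (K' :&: L') x.
  by rewrite -(elements_conforming hm Km Lm); split; exact: open_hull_sub.
pose w' k := if k \in L' then w k else 0.
have w'1 : \sum_(k in K') w' k = 1.
  by rewrite -w1 -big_mkcondr; apply: eq_bigl => k; rewrite !inE.
have xw' : x = \sum_(k in K') w' k *: vertex k.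
  rewrite xw (eq_bigl (fun k => (k \in K') && (k \in L'))) => [|k]; last first.
    by rewrite !inE.
  rewrite big_mkcondr; apply: eq_bigr => k _; rewrite /w'.
  by case: ifP => // _; rewrite scale0r.
have : v i - w' i = 0.
  apply: (element_nondegenerate hm Km (w := fun k => v k - w' k)) => //.
    by rewrite sumrB v1 w'1 subrr.
  by under eq_bigr do rewrite scalerBl; rewrite sumrB -xv -xw' subrr.
rewrite /w' (negbTE iL) subr0 => vi0.
by have := v0 _ iK; rewrite vi0 ltxx.
Qed.

Lemma skeleton_null : exists N, [/\ measurable N, mu N = 0%E &
  Omega `\` N `<=` \bigcup_(K in [set` elements m]) open_hull K].
Proof.
have [] := @null_bigsetU _ _ _ mu _ (index_enum {set 'I_(nvert m)}) [in elements m]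
    (fun K => hull K `\` open_hull K).
  move=> K Km; have [mK moK] := measurable_elements Km; split.
    exact: measurableD.
  have [e e_inj KE] := element_enum (element_card hm Km).
  exact: (hull_boundary_null hm Km e_inj KE).
set N := \big[_/_]_(_ <- _ | _) _ => mN N0; exists N; split => // x [Ox Nx].
have : closure Omega x by exact: subset_closure.
rewrite (elements_cover hm) => -[K /= Km Kx]; exists K => //.
apply: contrapT => noK; apply: Nx; rewrite /N -bigcup_seq_cond.
by exists K => //=; rewrite mem_index_enum.
Qed.

Lemma Rintegral_elements (f : 'rV[R]_d -> R) :
  (forall K, K \in elements m ->
    mu.-integrable (Omega `&` open_hull K) (EFin \o f)) ->
  \int[mu]_(x in Omega) f x =
  \sum_(K in elements m) \int[mu]_(x in Omega `&` open_hull K) f x.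
Proof.
move=> intf; have [N [mN N0 ON]] := skeleton_null.
(* Padding with empty sets indexes the pieces by all sets of vertices, a finite type. *)
pose F K := if K \in elements m then open_hull K else set0.
have mF K : measurable (F K).
  by rewrite /F; case: ifPn => // Km; have [] := measurable_elements Km.
rewrite (@Rintegral_partition _ _ _ mu _ Omega N F) => //.
- rewrite [RHS]big_mkcond; apply: eq_bigr => K _; rewrite /F; case: ifPn => // _.
  by rewrite setI0 Rintegral_set0.
- exact: measurable_domain.
- move=> K L _ _ [x []]; rewrite /F; case: ifPn => // Km Kx; case: ifPn => // Lm Lx.
  exact: (open_hull_disjoint Km Lm Kx Lx).
- by move=> x /ON[K /= Km Kx]; exists K => //; rewrite /F Km.
- move=> K; rewrite /F; case: ifPn => [Km|_]; first exact: intf.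
  by rewrite setI0; exact: integrable_set0.
Qed.

Lemma phi_partition_of_unity x : closure Omega x ->
  (forall j, 0 <= phi j x) /\ \sum_j phi j x = 1.
Proof.
rewrite (elements_cover hm) => -[K /= Km Kx].
have [e e_inj KE] := element_enum (element_card hm Km).
have uP := element_simplex_nondeg hm Km e_inj KE.
have Px : simplex (fun k => vertex (e k)) x.
  by rewrite -(hull_simplex hm Km e_inj KE).
split => [j|].
  rewrite (phi_bary hm hphi Km e_inj KE)// mxE sumr_ge0// => k _.
  by rewrite mulr_ge0 ?Px// mxE.
have [s1 _] := bary_sum x uP; rewrite -s1.
under eq_bigr do rewrite (phi_bary hm hphi Km e_inj KE)// mxE.
rewrite exchange_big; apply: eq_bigr => k _; rewrite -mulr_sumr.
rewrite (bigD1 (e k))//= big1 => [|j jk]; first by rewrite mxE eqxx addr0 mulr1.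
by rewrite mxE eq_sym (negbTE jk).
Qed.

Lemma phi_ge0 j x : Omega x -> 0 <= phi j x.
Proof. by move=> /subset_closure/phi_partition_of_unity[]. Qed.

Lemma phi_sum x : Omega x -> \sum_j phi j x = 1.
Proof. by move=> /subset_closure/phi_partition_of_unity[]. Qed.

Lemma phi_le1 j x : Omega x -> phi j x <= 1.
Proof.
move=> Ox; rewrite -(phi_sum Ox) (bigD1 j)//= lerDl sumr_ge0// => k _.
exact: phi_ge0.
Qed.

Lemma measurable_phi j : measurable_fun Omega (phi j).
Proof.
have -> : Omega = \big[setU/set0]_(K <- enum (elements m)) (Omega `&` hull K).
  rewrite -bigcup_seq -setI_bigcupr; apply/seteqP; split => [x Ox|x []//].
  split => //; have : closure Omega x by exact: subset_closure.
  rewrite (elements_cover hm) => -[K /= Km Kx].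
  by exists K => //=; rewrite mem_enum.
apply: measurable_fun_bigsetU => K; rewrite mem_enum => Km.
  apply: measurableI; first exact: measurable_domain.
  by have [] := measurable_elements Km.
have [e e_inj KE] := element_enum (element_card hm Km).
apply: (eq_measurable_fun (fun x => (bary (fun k => vertex (e k)) x *m
    \col_k (e k == j)%:R) 0 0)).
  by move=> x /set_mem[_ Kx]; rewrite (phi_bary hm hphi Km e_inj KE).
apply: measurable_funTS.
exact: (measurableT_comp (measurable_mulmx_coord (\col_k (e k == j)%:R) 0)
  (measurable_bary (fun k => vertex (e k)))).
Qed.

Lemma bounded_integrable (f : 'rV[R]_d -> R) (M : R) :
  measurable_fun Omega f -> (forall x, Omega x -> `|f x| <= M) ->
  mu.-integrable Omega (EFin \o f).
Proof.
move=> mf fM; apply: measurable_bounded_integrable => //.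
- exact: measurable_domain.
- by apply: lebesgue_rV_bounded => //; exact: measurable_domain.
- exists M; split; first exact: num_real.
  by move=> N MN x Ox; exact: le_trans (fM _ Ox) (ltW MN).
Qed.

Lemma phi_norm_le1 j x : Omega x -> `|phi j x| <= 1.
Proof. by move=> Ox; rewrite ger0_norm ?phi_le1// phi_ge0. Qed.

Lemma integrable_phi j : mu.-integrable Omega (EFin \o phi j).
Proof.
by apply: (@bounded_integrable _ 1); [exact: measurable_phi|exact: phi_norm_le1].
Qed.

Lemma integrable_phi_phi i j :
  mu.-integrable Omega (EFin \o (fun x => phi j x * phi i x)).
Proof.
apply: (@bounded_integrable _ 1).
  by apply: measurable_funM; exact: measurable_phi.
by move=> x Ox; rewrite normrM mulr_ile1// phi_norm_le1.
Qed.

(** The barycenter is only known to lie in the closure of [Omega], but the open element is a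
    neighbourhood of it and so meets [Omega]. *)
Lemma domain_open_hull_neq0 K : K \in elements m ->
  exists x, (Omega `&` open_hull K) x.
Proof.
move=> Km; have Kb := barycenter_open_hull Km.
have : closure Omega (barycenter K) by exact/(hull_closure Km)/open_hull_sub.
by apply; exact: (open_nbhs_nbhs (conj (open_hull_open Km) Kb)).
Qed.

(** On the nonempty open set where [Omega] meets the interior of an element with vertex [i], [phi i]
    is positive; a zero integral would make this set null. *)
Lemma Rintegral_phi_gt0 i : 0 < \int[mu]_(x in Omega) phi i x.
Proof.
have [K Km iK] := vertex_used hm i.
have [mK moK] := measurable_elements Km.
have mO := measurable_domain.
pose U := Omega `&` open_hull K.
have mU : measurable U by exact: measurableI.
have phiU x : U x -> 0 < phi i x.
  move=> [Ox Kx]; have [e e_inj KE] := element_enum (element_card hm Km).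
  move: iK; rewrite KE => /imsetP[k _ ->].
  rewrite (phi_bary_coord hm hphi Km e_inj KE); last exact: open_hull_sub.
  by move: Kx; rewrite (open_hull_simplex hm Km e_inj KE) => /(_ k).
have mphi : measurable_fun U (phi i).
  by apply: measurable_funS (measurable_phi i) => // x [].
apply: (@lt_le_trans _ _ (\int[mu]_(x in U) phi i x)); last first.
  apply: Rintegral_subset => //; first by move=> x [].
    exact: integrable_phi.
  by move=> x; exact: phi_ge0.
have iU : mu.-integrable U (EFin \o phi i).
  by apply: integrableS (integrable_phi i) => // x [].
rewrite lt0r Rintegral_ge0 ?andbT; last by move=> x /phiU/ltW.
apply/eqP => I0.
have : (\int[mu]_(x in U) `|(phi i x)%:E|)%E = 0%E.
  rewrite (eq_integral (EFin \o phi i)) => [|x /set_mem/phiU/ltW xi].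
    by rewrite -[LHS]fineK; [congr EFin|exact: integrable_fin_num].
  by rewrite /= ger0_norm.
move/(ae_eq_integral_abs mu mU) => /(_ _)[]; first exact/measurable_EFinP.
move=> N [mN N0 UN].
have : (0 < mu U)%E.
  apply: lebesgue_rV_open_gt0; first by apply: openI => //; exact: open_hull_open.
  exact: domain_open_hull_neq0.
rewrite (_ : mu U = 0%E) ?ltxx//; apply: (subset_measure0 mU mN) => // x Ux.
apply: UN => /= /(_ Ux)/eqP; rewrite eqe => /eqP xi.
by have := phiU x Ux; rewrite xi ltxx.
Qed.

(** For two vertices of [K] this is the moment bound, integrated over a subset of the simplex;
    otherwise one of the two functions vanishes on [K]. *)
Lemma mass_element_le K i j : K \in elements m -> i != j ->
  \int[mu]_(x in Omega `&` open_hull K) (phi j x * phi i x) * (d.+1%:R * d.+2%:R) <=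
  if (i \in K) && (j \in K) then vol (hull K) else 0.
Proof.
move=> Km ij; have [e e_inj KE] := element_enum (element_card hm Km).
have uP := element_simplex_nondeg hm Km e_inj KE.
have [mK moK] := measurable_elements Km; have mO := measurable_domain.
case: ifPn => [/andP[]|ijK].
  rewrite {1 2}KE => /imsetP[k _ ik] /imsetP[l _ jl].
  have kl : k != l by apply: contra ij => /eqP kl; rewrite ik jl kl.
  rewrite (hull_simplex hm Km e_inj KE).
  apply: le_trans (moment_offdiag_vol uP kl); rewrite ler_wpM2r ?mulr_ge0//.
  have iM := integrable_bary uP (barycentric_boundedM k l).
  have sub : Omega `&` open_hull K `<=` simplex (fun k => vertex (e k)).
    by move=> x [_ /open_hull_sub]; rewrite (hull_simplex hm Km e_inj KE).
  rewrite [leLHS](_ : _ = \int[mu]_(x in Omega `&` open_hull K)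
      (bary (fun k => vertex (e k)) x 0 k * bary (fun k => vertex (e k)) x 0 l)).
    apply: Rintegral_subset => //.
    - exact: measurableI.
    - exact: measurable_simplex.
    - by move=> x Px; rewrite mulr_ge0// Px.
  apply: eq_Rintegral => x /set_mem[_ /open_hull_sub Kx].
  by rewrite ik jl !(phi_bary_coord hm hphi Km e_inj KE)// mulrC.
have phi0 n x : n \notin K -> hull K x -> phi n x = 0.
  move=> nK Kx; rewrite (phi_bary hm hphi Km e_inj KE)//.
  by rewrite (node0 KE nK) mulmx0 mxE.
rewrite (_ : \int[mu]_(x in _) _ = 0) ?mul0r//.
rewrite -(mul0r (fine (mu (Omega `&` open_hull K)))).
rewrite -Rintegral_cst; last exact: measurableI.
apply: eq_Rintegral => x /set_mem[_ /open_hull_sub Kx].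
by move: ijK; rewrite negb_and => /orP[] nK; rewrite (phi0 _ _ nK Kx) ?mulr0 ?mul0r.
Qed.

Lemma grad_on_open_hull K j x : K \in elements m -> open_hull K x ->
  grad (phi j) x = grad_on phi K j.
Proof.
move=> Km Kx; have [e e_inj KE] := element_enum (element_card hm Km).
rewrite /grad_on !(grad_bary hm hphi Km e_inj KE)//; exact: barycenter_open_hull.
Qed.

Lemma sum_grad_on K : K \in elements m -> \sum_j grad_on phi K j = 0.
Proof.
move=> Km; have [e e_inj KE] := element_enum (element_card hm Km).
rewrite -[RHS](sum_grad_bary hm Km e_inj KE); apply: eq_bigr => j _.
by rewrite /grad_on (grad_bary hm hphi Km e_inj KE)//; exact: barycenter_open_hull.
Qed.

Lemma grad_on0 K j : K \in elements m -> j \notin K -> grad_on phi K j = 0.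
Proof.
move=> Km jK; have [e e_inj KE] := element_enum (element_card hm Km).
rewrite /grad_on (grad_bary hm hphi Km e_inj KE); last exact: barycenter_open_hull.
by rewrite (node0 KE jK) mulmx0.
Qed.

End mesh_integrals.

(** * The scheme *)

Lemma minimum_principle (R : realFieldType) (n : nat) (B : 'M[R]_n)
    (v : 'cV[R]_n) (I : pred 'I_n) :
  (forall i j, I i -> i != j -> B i j <= 0) ->
  (forall i, I i -> 0 < \sum_j B i j) ->
  (forall i, I i -> 0 <= (B *m v) i 0) ->
  (forall i, ~~ I i -> 0 <= v i 0) ->
  forall i, 0 <= v i 0.
Proof.
move=> Boff Bsum Bv vI i.
case: (@arg_minP _ R _ i xpredT (fun k => v k 0)) => // k _ vk.
apply: le_trans (vk i isT); have [Ik|/vI//] := boolP (I k).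
rewrite leNgt; apply/negP => vk0; have := Bv k Ik; rewrite leNgt => /negP; apply.
(* At a minimal entry [v k 0 < 0], row [k] splits into [v k 0] times the row sum, which is negative,
   and off-diagonal entries times the differences [v j 0 - v k 0], which are nonpositive terms. *)
rewrite mxE (eq_bigr (fun j => v k 0 * B k j + B k j * (v j 0 - v k 0))); last first.
  by move=> j _; ring.
rewrite big_split/= -mulr_sumr -[ltRHS]addr0 ltr_leD//.
  by rewrite nmulr_rlt0 ?Bsum.
apply: sumr_le0 => j _; have [->|kj] := eqVneq j k; first by rewrite subrr mulr0.
by rewrite mulr_le0_ge0 ?subr_ge0 ?vk// Boff// eq_sym.
Qed.

Lemma mulmx_bilinear (R : pzRingType) (n : nat) (g h : 'cV[R]_n) (A : 'M[R]_n) :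
  (g^T *m A *m h) 0 0 = \sum_l \sum_k g k 0 * A k l * h l 0.
Proof.
rewrite mxE; apply: eq_bigr => l _; rewrite mxE mulr_suml.
by apply: eq_bigr => k _; rewrite mxE.
Qed.

(** * Entries of the mass and stiffness matrices *)

Section scheme_matrices.
Context {R : realType} {d : nat} (Omega : set 'rV[R]_d) (m : mesh R d).
Context (phi : 'I_(nvert m) -> 'rV[R]_d -> R) (D : 'rV[R]_d -> 'M[R]_d).
Hypotheses (d_gt0 : (0 < d)%N) (hOmega : polyhedral_domain Omega)
  (hm : triangulation Omega m) (hphi : nodal_basis Omega phi)
  (hD : diffusion_tensor Omega D).
Implicit Types K L : {set 'I_(nvert m)}.
Local Notation mu := (lebesgue_rV R d).

Let oOmega : open Omega. Proof. by case: hOmega. Qed.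
Let bOmega : bounded_set Omega. Proof. by case: hOmega. Qed.
Let mOmega : measurable Omega. Proof. exact: measurable_domain. Qed.

Lemma integrable_diffusion K k l : K \in elements m ->
  mu.-integrable (Omega `&` open_hull K) (EFin \o (fun x => D x k l)).
Proof.
move=> Km; have [mK moK] := measurable_elements hm Km; case: hD => _ intD _ _.
by apply: (integrableS mOmega _ _ (intD k l)); [exact: measurableI|move=> x []].
Qed.

(** The average is taken over the closed element; its faces form a null set. *)
Lemma average_on_open_hull K k l : K \in elements m ->
  \int[mu]_(x in Omega `&` open_hull K) D x k l =
  vol (hull K) * average_on Omega D K k l.
Proof.
move=> Km; have [mK moK] := measurable_elements hm Km.
rewrite mxE mulrA (mulfV (lt0r_neq0 (vol_hull_gt0 hm Km))).
rewrite mul1r /Rintegral; congr fine.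
have [e e_inj KE] := element_enum (element_card hm Km).
have null := hull_boundary_null hm Km e_inj KE d_gt0.
rewrite [RHS](integral_setD_null _ _ _ null); last exact: measurableD.
congr (integral _ _ _); apply/seteqP; split => x.
  by move=> [Ox Kx]; split; [split => //; exact: open_hull_sub|case].
by move=> [[Kx Ox] nKx]; split => //; apply: contrapT => noKx; apply: nKx.
Qed.

(** Gradients are constant on each open element, so expanding the bilinear form leaves only
    integrals of the entries of [D]. *)
Lemma stiffness_elements (g h : 'I_(nvert m)) :
  \int[mu]_(x in Omega) ((grad (phi g) x)^T *m D x *m grad (phi h) x) 0 0 =
  \sum_(K in elements m) vol (hull K) *
    ((grad_on phi K g)^T *m average_on Omega D K *m grad_on phi K h) 0 0.
Proof.
have E K x : K \in elements m -> x \in Omega `&` open_hull K ->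
    ((grad (phi g) x)^T *m D x *m grad (phi h) x) 0 0 =
    \sum_l \sum_k grad_on phi K g k 0 * grad_on phi K h l 0 * D x k l.
  move=> Km /set_mem[_ Kx].
  rewrite !(grad_on_open_hull hm hphi _ Km Kx) mulmx_bilinear.
  by apply: eq_bigr => l _; apply: eq_bigr => k _; rewrite mulrAC.
have intE K k l (c : R) : K \in elements m ->
    mu.-integrable (Omega `&` open_hull K) (EFin \o (fun x => c * D x k l)).
  move=> Km; have [mK moK] := measurable_elements hm Km.
  by apply: (integrableZl _ c (integrable_diffusion k l Km)); exact: measurableI.
rewrite (Rintegral_elements d_gt0 hm oOmega).
  apply: eq_bigr => K Km; have [mK moK] := measurable_elements hm Km.
  have mOK : measurable (Omega `&` open_hull K) by exact: measurableI.
  under eq_Rintegral do [rewrite (E K _ Km)//].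
  rewrite Rintegral_sum// => [|l]; last first.
    by apply: integrable_Rsum => // k; exact: intE.
  rewrite mulmx_bilinear mulr_sumr; apply: eq_bigr => l _.
  rewrite Rintegral_sum// => [|k]; last exact: intE.
  rewrite mulr_sumr; apply: eq_bigr => k _.
  rewrite RintegralZl//; last exact: integrable_diffusion.
  by rewrite average_on_open_hull//; ring.
move=> K Km; have [mK moK] := measurable_elements hm Km.
have mOK : measurable (Omega `&` open_hull K) by exact: measurableI.
apply: (@eq_integrable _ _ _ mu _ mOK (EFin \o (fun x =>
  \sum_l \sum_k grad_on phi K g k 0 * grad_on phi K h l 0 * D x k l))).
  by move=> x xK; rewrite /= (E K).
by apply: integrable_Rsum => // l; apply: integrable_Rsum => // k; exact: intE.
Qed.

Lemma mesh_scale_gt0 : 0 < mesh_scale Omega m.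
Proof.
case: hOmega => _ [x0 Ox0] _ _ _.
rewrite /mesh_scale powR_gt0// divr_gt0//.
  rewrite /vol fine_gt0// lebesgue_rV_bounded// lebesgue_rV_open_gt0//.
  by exists x0.
rewrite ltr0n; apply/card_gt0P.
have : closure Omega x0 by exact: subset_closure.
by rewrite (elements_cover hm) => -[K /= Km _]; exists K.
Qed.

Definition acute_inf : R := inf [set v | exists K i j,
    [/\ K \in elements m, i \in K, j \in K, i != j &
        v = - ((grad_on phi K i)^T *m average_on Omega D K *m
                 grad_on phi K j) 0 0]].

Lemma acute_inf_le K i j : K \in elements m -> i \in K -> j \in K -> i != j ->
  acute_inf <=
  - ((grad_on phi K i)^T *m average_on Omega D K *m grad_on phi K j) 0 0.
Proof.
move=> Km iK jK ij; apply: ge_inf; last by exists K, i, j.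
pose s K i j :=
  ((grad_on phi K i)^T *m average_on Omega D K *m grad_on phi K j) 0 0.
(* A crude lower bound of the set, required for [inf] to be a genuine infimum. *)
exists (- \sum_K \sum_i \sum_j `|s K i j|) => _ [K' [i' [j' [_ _ _ _ ->]]]].
rewrite lerN2 -/(s _ _ _).
have nn (I : finType) (F : I -> R) k : (forall k, 0 <= F k) -> F k <= \sum_k F k.
  by move=> F0; rewrite (bigD1 k)//= lerDl sumr_ge0.
apply: le_trans (ler_norm _) _.
apply: le_trans (nn _ (fun j => `|s K' i' j|) j' _) _ => //.
apply: le_trans (nn _ (fun i => \sum_j `|s K' i j|) i' _) _ => [i''|].
  exact: sumr_ge0.
apply: (nn _ (fun K => \sum_i \sum_j `|s K i j|) K') => K''.
by apply: sumr_ge0 => i'' _; exact: sumr_ge0.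
Qed.

(** With [c = (d+1)(d+2)], an element containing both vertices contributes at most
    [|K| / c + dt |K| q], where [q <= - acute_inf]; the lower bound on [dt] says that
    [dt * c * acute_inf >= 1]. Other elements contribute at most 0. *)
Lemma scheme_offdiag_le0 (dt : R) (i j : 'I_(nvert m)) :
  (i < nint m)%N -> i != j -> 0 <= dt ->
  0 <= D_acute Omega D phi ->
  ((mesh_scale Omega m)%:E
     / (d.+1%:R * d.+2%:R * D_acute Omega D phi)%:E <= dt%:E)%E ->
  (mass_matrix Omega phi + dt *: stiffness_matrix Omega D phi) i j <= 0.
Proof.
move=> ii ij dt0 Da0 hdt; have s0 := mesh_scale_gt0.
set c : R := d.+1%:R * d.+2%:R; have c0 : 0 < c by rewrite mulr_gt0.
have dt1 : 1 <= dt * (c * acute_inf).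
  have DE : D_acute Omega D phi = mesh_scale Omega m * acute_inf by [].
  (* If [D_acute] is zero the quotient is [+oo], which no real [dt] reaches. *)
  have [Dz|Dnz] := eqVneq (D_acute Omega D phi) 0.
    by move: hdt; rewrite Dz mulr0 inve0 gt0_muley ?lte_fin.
  have Dp : 0 < D_acute Omega D phi by rewrite lt0r Dnz.
  have ap : 0 < acute_inf by move: Dp; rewrite DE pmulr_rgt0.
  move: hdt; rewrite inver gt_eqF ?mulr_gt0// -EFinM lee_fin.
  rewrite ler_pdivrMr ?mulr_gt0//.
  by rewrite DE -(ler_pM2l s0) mulr1 => /le_trans; apply; rewrite -/c; nra.
rewrite !mxE ii stiffness_elements.
rewrite (Rintegral_elements d_gt0 hm oOmega); last first.
  move=> K Km; have [mK moK] := measurable_elements hm Km.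
  apply: (integrableS mOmega _ _ (integrable_phi_phi hm hphi oOmega bOmega i j)).
    exact: measurableI.
  by move=> x [].
rewrite mulr_sumr -big_split/=; apply: sumr_le0 => K Km.
have vK := vol_hull_gt0 hm Km; set q := ((_ *m _ *m _) 0 0).
have := mass_element_le hm hphi oOmega Km ij; rewrite -/c -ler_pdivlMr//.
case: ifPn => [/andP[iK jK]|ijK].
  have := acute_inf_le Km iK jK ij; rewrite -/q => aq h.
  have dtq : 1 <= dt * (c * - q).
    by apply: le_trans dt1 _; rewrite ler_wpM2l// ler_pM2l.
  apply: le_trans (lerD h (lexx _)) _.
  rewrite mulrCA -mulrDr pmulr_rle0// -(ler_pM2l c0) mulr0 mulrDr mulfV ?gt_eqF//.
  by move: dtq; rewrite mulrCA mulrN mulrN; lra.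
rewrite mul0r => h; suff -> : q = 0 by rewrite !mulr0 addr0.
rewrite /q; move: ijK; rewrite negb_and => /orP[] nK;
  rewrite (grad_on0 hm hphi Km nK).
  by rewrite trmx0 !mul0mx mxE.
by rewrite mulmx0 mxE.
Qed.

End scheme_matrices.

(** * One time step for the Nagumo reaction *)

Section nagumo_step.
Context {R : realType} {d : nat} (Omega : set 'rV[R]_d) (m : mesh R d).
Context (phi : 'I_(nvert m) -> 'rV[R]_d -> R) (D : 'rV[R]_d -> 'M[R]_d).
Hypotheses (d_gt0 : (0 < d)%N) (hOmega : polyhedral_domain Omega)
  (hm : triangulation Omega m) (hphi : nodal_basis Omega phi)
  (hD : diffusion_tensor Omega D).
Variables (a dt : R) (u u' b : 'cV[R]_(nvert m)).
Hypotheses (ha : 0 < a < 1) (dt_gt0 : 0 < dt) (u01 : forall j, 0 <= u j 0 <= 1)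
  (b_interior : forall i : 'I_(nvert m), (i < nint m)%N -> b i 0 = 0)
  (b_boundary : forall i : 'I_(nvert m), ~~ (i < nint m)%N -> 0 <= b i 0 <= 1).
Hypothesis scheme :
  (mass_matrix Omega phi + dt *: stiffness_matrix Omega D phi) *m u' =
  (mass_matrix Omega phi + dt *: reaction_matrix Omega phi (nagumo a) u) *m u
    + dt *: b.
Hypothesis hacute : 0 <= D_acute Omega D phi.
Hypothesis dt_ge : ((mesh_scale Omega m)%:E
  / (d.+1%:R * d.+2%:R * D_acute Omega D phi)%:E <= dt%:E)%E.
Hypothesis dt_le :
  (dt%:E <= 1%:E / (reaction_bound a Omega (fe_function phi u))%:E)%E.
Local Notation mu := (lebesgue_rV R d).
Local Notation uh := (fe_function phi u).

Let oOmega : open Omega. Proof. by case: hOmega. Qed.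
Let bOmega : bounded_set Omega. Proof. by case: hOmega. Qed.
Let mOmega : measurable Omega. Proof. exact: measurable_domain. Qed.

Lemma fe_function01 (v : 'cV[R]_(nvert m)) x : (forall j, 0 <= v j 0 <= 1) ->
  closure Omega x -> 0 <= fe_function phi v x <= 1.
Proof.
move=> v01 /(phi_partition_of_unity hm hphi)[phi0 phi1]; apply/andP; split.
  by apply: sumr_ge0 => j _; rewrite mulr_ge0//; have /andP[] := v01 j.
rewrite -phi1; apply: ler_sum => j _; rewrite ler_piMl//.
by have /andP[] := v01 j.
Qed.

Lemma dt_reaction_le1 x : Omega x ->
  0 <= 1 + dt * nagumo a (uh x) /\ 0 <= 1 + dt * (uh x * (a - uh x)).
Proof.
move=> Ox; set r := reaction_bound a Omega uh.
pose F x := Num.max `|Num.min (nagumo a (uh x)) 0| `|Num.min (uh x * (a - uh x)) 0|.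
have Fr : F x <= r.
  apply: ub_le_sup; last by exists x => //; exact: subset_closure.
  (* Since [uh] lies in [[0, 1]] and [0 < a < 1], each reaction term is a factor in [[0, 1]] times a
     factor at least -1, so the set under [sup] is bounded by 1. *)
  exists 1 => _ [y cy <-]; have := fe_function01 u01 cy; set w := uh y => w01.
  have min1 (z : R) : -1 <= z -> `|Num.min z 0| <= 1.
    move=> z1; rewrite ler0_norm ?ge_min ?lexx ?orbT//.
    by rewrite lerNl le_min z1 oppr_le0 ler01.
  have prod (s z : R) : 0 <= s <= 1 -> -1 <= z -> -1 <= s * z.
    move=> /andP[s0 s1] z1.
    by have := mulr_ge0 s0 (_ : 0 <= z + 1); rewrite mulrDr; lra.
  rewrite ge_max !min1//; apply: prod; move: ha w01; lra.
have F0 : 0 <= F x by rewrite le_max normr_ge0.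
have dtr : dt * r <= 1.
  (* For [r = 0] the upper bound on [dt] is [+oo], but then [dt * r] vanishes. *)
  have [r0|r0] := eqVneq r 0; first by rewrite r0 mulr0.
  have rp : 0 < r by rewrite lt0r r0 (le_trans F0 Fr).
  move: dt_le; rewrite -/r inver (negbTE r0) -EFinM lee_fin mul1r.
  by rewrite -(ler_pM2r rp) mulVf.
have bound z : `|Num.min z 0| <= r -> 0 <= 1 + dt * z.
  move=> zr; have : - r <= z.
    by move: zr; rewrite ler_norml => /andP[+ _]; rewrite le_min => /andP[].
  by move=> /(ler_wpM2l (ltW dt_gt0)); rewrite mulrN; lra.
by split; apply: bound; apply: le_trans Fr; rewrite le_max lexx ?orbT.
Qed.

Lemma measurable_fe_function (v : 'cV[R]_(nvert m)) :
  measurable_fun Omega (fe_function phi v).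
Proof.
apply: measurable_sum => j; apply: measurable_funM; first exact: measurable_cst.
exact: measurable_phi.
Qed.

Lemma measurable_nagumo : measurable_fun Omega (fun x => nagumo a (uh x)).
Proof.
have mu_ := measurable_fe_function u.
by apply: measurable_funM; apply: measurable_funB => //; exact: measurable_cst.
Qed.

Lemma nagumo_norm_le1 x : Omega x -> `|nagumo a (uh x)| <= 1.
Proof.
move=> /subset_closure/(fe_function01 u01) w01; rewrite /nagumo normrM.
by rewrite mulr_ile1// ler_norml; move: ha w01; lra.
Qed.

Lemma integrable_reaction i j : mu.-integrable Omega
  (EFin \o (fun x => nagumo a (uh x) * phi j x * phi i x)).
Proof.
apply: (@bounded_integrable _ _ _ oOmega bOmega _ 1).
  apply: measurable_funM; last exact: measurable_phi.
  by apply: measurable_funM; [exact: measurable_nagumo|exact: measurable_phi].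
move=> x Ox; have phi1 k := phi_norm_le1 hm hphi k Ox.
have f1 := nagumo_norm_le1 Ox.
rewrite (normrM (_ * _)) mulr_ile1 ?phi1//.
by rewrite (normrM (nagumo _ _)) mulr_ile1 ?phi1.
Qed.

Let rhs x := (1 + dt * nagumo a (uh x)) * uh x.

(** Summing over [j] under the integral reassembles [uh] from its nodal values. The integrability
    part is used to subtract this integral from that of [phi i]. *)
Lemma reaction_row (i : 'I_(nvert m)) : (i < nint m)%N ->
  ((mass_matrix Omega phi
    + dt *: reaction_matrix Omega phi (nagumo a) u) *m u) i 0 =
  \int[mu]_(x in Omega) (rhs x * phi i x) /\
  mu.-integrable Omega (EFin \o (fun x => rhs x * phi i x)).
Proof.
move=> ii.
pose F j x :=
  (phi j x * phi i x + dt * (nagumo a (uh x) * phi j x * phi i x)) * u j 0.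
have iR j := integrableZl mOmega dt (integrable_reaction i j).
have iphi j := integrable_phi_phi hm hphi oOmega bOmega i j.
have iF0 j : mu.-integrable Omega (EFin \o (fun x =>
    phi j x * phi i x + dt * (nagumo a (uh x) * phi j x * phi i x))).
  exact: (integrableD mOmega (iphi j) (iR j)).
have iF j : mu.-integrable Omega (EFin \o F j).
  exact: (integrableZr mOmega (u j 0) (iF0 j)).
have FE x : \sum_j F j x = rhs x * phi i x.
  rewrite /rhs /fe_function mulr_sumr mulr_suml; apply: eq_bigr => j _.
  by rewrite /F; ring.
have -> : (fun x => rhs x * phi i x) = (fun x => \sum_j F j x) by apply/funext => x.
split; last exact: integrable_Rsum.
rewrite Rintegral_sum// mxE; apply: eq_bigr => j _.
rewrite RintegralZr// RintegralD//; last exact: iR.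
by rewrite RintegralZl ?mxE ?ii//; exact: integrable_reaction.
Qed.

Lemma scheme_row_sum (i : 'I_(nvert m)) : (i < nint m)%N ->
  \sum_j (mass_matrix Omega phi + dt *: stiffness_matrix Omega D phi) i j =
  \int[mu]_(x in Omega) phi i x.
Proof.
move=> ii; under eq_bigr do rewrite !mxE ii.
rewrite big_split/= -mulr_sumr -Rintegral_sum//; last first.
  by move=> j; exact: integrable_phi_phi.
rewrite [X in _ + dt * X](_ : _ = 0) ?mulr0 ?addr0.
  apply: eq_Rintegral => x /set_mem Ox.
  by rewrite -mulr_suml (phi_sum hm hphi Ox) mul1r.
under eq_bigr do rewrite (stiffness_elements d_gt0 hOmega hm hphi hD).
rewrite exchange_big big1// => K Km; rewrite -mulr_sumr.
set g := _ *m _; rewrite (_ : \sum_j _ = (g *m \sum_j grad_on phi K j) 0 0).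
  by rewrite (sum_grad_on hm hphi Km) mulmx0 mxE mulr0.
by rewrite mulmx_sumr summxE.
Qed.

Lemma nagumo_step : forall j, 0 <= u' j 0 <= 1.
Proof.
set B := mass_matrix Omega phi + dt *: stiffness_matrix Omega D phi.
have Boff (i j : 'I_(nvert m)) : (i < nint m)%N -> i != j -> B i j <= 0.
  by move=> ii ij; apply: scheme_offdiag_le0 => //; exact: ltW.
have Bsum (i : 'I_(nvert m)) : (i < nint m)%N -> 0 < \sum_j B i j.
  by move=> ii; rewrite scheme_row_sum//; exact: Rintegral_phi_gt0.
have Bu' (i : 'I_(nvert m)) : (i < nint m)%N ->
    (B *m u') i 0 = \int[mu]_(x in Omega) (rhs x * phi i x).
  move=> ii; rewrite scheme mxE (reaction_row ii).1.
  by rewrite [X in _ + X]mxE b_interior// mulr0 addr0.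
(* In a boundary row the mass and reaction matrices vanish and the stiffness matrix is the identity,
   so the scheme reads [dt * u'_i = dt * b_i]. *)
have u'b (i : 'I_(nvert m)) : ~~ (i < nint m)%N -> u' i 0 = b i 0.
  move=> ii; have /colP/(_ i) := scheme.
  rewrite [RHS]mxE [X in _ = X + _]mxE big1 ?add0r => [|j _]; last first.
    by rewrite !mxE (negbTE ii) mulr0 addr0 mul0r.
  rewrite [RHS]mxE mxE (bigD1 i)//= big1 ?addr0 => [|j ji]; last first.
    by rewrite !mxE (negbTE ii) eq_sym (negbTE ji) mulr0 addr0 mul0r.
  rewrite !mxE (negbTE ii) eqxx add0r mulr1.
  exact/mulfI/lt0r_neq0.
have w01 x : Omega x -> 0 <= uh x <= 1.
  by move=> /subset_closure; exact: fe_function01.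
have u'0 : forall j, 0 <= u' j 0.
  apply: (@minimum_principle _ _ B u' (fun i => (i < nint m)%N)) => //.
    move=> i ii; rewrite Bu'//; apply: Rintegral_ge0 => x Ox.
    have [h _] := dt_reaction_le1 Ox; have /andP[w0 _] := w01 x Ox.
    by rewrite !mulr_ge0// (phi_ge0 hm hphi).
  by move=> i ii; rewrite u'b//; have /andP[] := b_boundary ii.
suff u'1 : forall j, 0 <= (const_mx 1 - u') j 0.
  by move=> j; have := u'1 j; rewrite !mxE subr_ge0 u'0.
apply: (@minimum_principle _ _ B _ (fun i => (i < nint m)%N)) => //.
  move=> i ii; rewrite mulmxBr mxE [X in _ + X]mxE Bu'//.
  rewrite [X in X - _](_ : _ = \sum_j B i j); last first.
    by rewrite mxE; apply: eq_bigr => j _; rewrite [const_mx _ _ _]mxE mulr1.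
  rewrite scheme_row_sum// -RintegralB//; last 2 first.
    exact: integrable_phi.
    exact: (reaction_row ii).2.
  apply: Rintegral_ge0 => x Ox; have [_ h] := dt_reaction_le1 Ox.
  have /andP[_ w1] := w01 x Ox.
  (* The identity [1 - (1 + dt (1-w)(w-a)) w = (1-w)(1 + dt w (a-w))] is the source of the second
     term in [reaction_bound]. *)
  rewrite (_ : _ - _ = (1 - uh x) * (1 + dt * (uh x * (a - uh x))) * phi i x).
    by rewrite !mulr_ge0 ?subr_ge0// (phi_ge0 hm hphi).
  by rewrite /rhs /nagumo; ring.
by move=> i ii; rewrite !mxE u'b// subr_ge0; have /andP[] := b_boundary ii.
Qed.

End nagumo_step.

Theorem theorem5p1 (R : realType) (d : nat) (hd : (1 <= d <= 3)%N)
  (Omega : set 'rV[R]_d) (hOmega : polyhedral_domain Omega)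
  (T : R) (hT : 0 < T)
  (D : 'rV[R]_d -> 'M[R]_d) (hD : diffusion_tensor Omega D)
  (m : mesh R d) (hm : triangulation Omega m)
  (phi : 'I_(nvert m) -> 'rV[R]_d -> R) (hphi : nodal_basis Omega phi)
  (a : R) (ha : 0 < a < 1)
  (u0 : 'rV[R]_d -> R)
  (hu0 : forall x, (Omega `|` range (@vertex R d m)) x -> 0 <= u0 x <= 1)
  (g : 'rV[R]_d -> R -> R)
  (hg : forall x s, boundary Omega x -> 0 < s <= T -> 0 <= g x s <= 1)
  (N : nat) (t : nat -> R) (ht0 : t 0%N = 0)
  (ht : forall n, (n < N)%N -> t n < t n.+1) (htT : t N <= T)
  (u : nat -> 'cV[R]_(nvert m))
  (hinit : forall j, u 0%N j 0 = u0 (vertex j))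
  (hscheme : forall n, (n < N)%N ->
    let dt := t n.+1 - t n in
    (mass_matrix Omega phi + dt *: stiffness_matrix Omega D phi) *m u n.+1 =
    (mass_matrix Omega phi
      + dt *: reaction_matrix Omega phi (nagumo a) (u n)) *m u n
      + dt *: boundary_vector m g (t n.+1))
  (hacute : 0 <= D_acute Omega D phi)
  (hstep : forall n, (n < N)%N ->
    let dt := t n.+1 - t n in
    ((mesh_scale Omega m)%:E
       / (d.+1%:R * d.+2%:R * D_acute Omega D phi)%:E <= dt%:E)%E /\
    (dt%:E <= 1%:E / (reaction_bound a Omega (fe_function phi (u n)))%:E)%E) :
  forall n, (n <= N)%N ->
    (forall j, 0 <= u n j 0 <= 1) /\
    (forall x, Omega x -> 0 <= fe_function phi (u n) x <= 1).
Proof.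
have d_gt0 : (0 < d)%N by case/andP: hd.
have t_mono i k : (i + k <= N)%N -> t i <= t (i + k)%N.
  elim: k => [|k IH]; first by rewrite addn0.
  rewrite addnS => ikN; apply: le_trans (IH (ltnW ikN)) _.
  exact/ltW/ht.
have uh01 n : (forall j, 0 <= u n j 0 <= 1) ->
    (forall x, Omega x -> 0 <= fe_function phi (u n) x <= 1).
  by move=> un01 x /subset_closure; exact: (fe_function01 hm hphi).
suff un01 n : (n <= N)%N -> forall j, 0 <= u n j 0 <= 1.
  by move=> n nN; split; [exact: un01|apply: uh01; exact: un01].
elim: n => [_ j|n IH nN]; first by rewrite hinit hu0//; right; exists j.
have [dt_ge dt_le] := hstep n nN.
(* The bounds on [g] hold for times in [(0, T]], so the new time level must be placed there. *)
have tn : 0 < t n.+1 <= T.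
  apply/andP; split.
    by apply: le_lt_trans (ht _ nN); rewrite -ht0; exact: (t_mono 0%N n (ltnW nN)).
  by apply: le_trans htT; have := t_mono n.+1 (N - n.+1)%N; rewrite subnKC//; apply.
apply: (nagumo_step d_gt0 hOmega hm hphi hD ha _ (IH (ltnW nN)) _ _ (hscheme _ nN)) => //.
- by rewrite subr_gt0 ht.
- by move=> i ii; rewrite mxE ii.
(* A vertex off the boundary would be numbered among the first [nint m], so this one lies on the
   boundary and [hg] applies. *)
- move=> i ii; rewrite mxE (negbTE ii); apply: hg => //; apply: contrapT => nb.
  by move/negP: ii; apply; apply/(interior_first hm).
Qed.
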